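(* There is $C > 0$ such that for any subset $F \subset \mathbb{Z}$ of finite cardinality, \[ \Big|\Big\{x \in \mathbb{Z} : \sup_{N \in \mathbb{N}} \mathcal{A}_N\big(\mathbf{1}_F\big)(x) > \lambda\Big\}\Big| \leq C \lambda^{-1} \log^2(e/\lambda)\, |F| \] for all $0 < \lambda < 1$.
   Context: $\mathbb{N}$ is the set of positive integers, $|\cdot|$ of a set is its cardinality, $\mathbf{1}_F$ is the indicator function of $F$, and $\log^2(y) = (\log y)^2$. Let $\mathbb{P}_N$ be the set of prime numbers not larger than $N$ and $\pi(N) = \#\mathbb{P}_N$. For $f : \mathbb{Z} \to \mathbb{C}$, \[ \mathcal{A}_N f(x) = \frac{1}{\pi(N)} \sum_{p \in \mathbb{P}_N} f(x+p), \] with the convention $\mathcal{A}_1 f = 0$ (as $\pi(1)=0$). *)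

(* Defs.v *)
From HB Require Import structures.
From mathcomp Require Import all_boot all_order all_algebra.
From mathcomp Require Import all_classical all_reals all_analysis.

Set Implicit Arguments.
Unset Strict Implicit.
Unset Printing Implicit Defensive.

Import Order.TTheory GRing.Theory Num.Theory.

Local Open Scope ring_scope.

Definition primes_upto (N : nat) : seq nat := [seq p <- iota 1 N | prime p].

Definition prime_pi (N : nat) : nat := size (primes_upto N).

(* The coefficient field K covers real-valued and complex-valued f at once.
   When prime_pi N = 0 the sum is empty, so the average is 0. *)
Definition prime_avg (K : numFieldType) (N : nat) (f : int -> K) (x : int) : K :=
  (prime_pi N)%:R^-1 * \sum_(p <- primes_upto N) f (x + p%:Z).

(* The supremum is taken in the extended reals, so that it is the true
   supremum with no boundedness proviso on f. *)
Definition prime_maximal (R : realType) (f : int -> R) (x : int) : \bar R :=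
  ereal_sup [set (prime_avg N f x)%:E | N in [set N : nat | (0 < N)%N]]%classic.

(* Main.v *)
Require Import Defs.
From HB Require Import structures.
From mathcomp Require Import all_classical all_reals all_analysis.
From mathcomp Require Import all_boot all_order all_algebra.
From mathcomp Require Import finmap ring lra zify.

(** Why the estimate holds.

    Indicator functions are nonnegative, so an upper bound for the averages over
    primes is all that is needed, and the primes up to [N] may be replaced by a
    nonnegative sieve majorant whose arithmetic structure is explicit.  Choose
    [a] with [2^a] comparable to [1/lambda], and let [level 0 = 2^(20a)].  The
    majorant ignores the primes up to [level 0].  By Mertens' product this raises
    its mean from order [1] to a quantity of order at most [a^2]
    ([mertens_product_le], [sieve_mass_ge]); this is where [log^2 (e/lambda)]
    comes from.  What is gained is that every nontrivial modulus in the
    expansion of the majorant exceeds a large power of [1/lambda].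

    At the scale [N ~ 2^n] the majorant is [L S^2 / (V h^2)].  The factor [L]
    ([rough_weight]) sieves exactly by the primes between [level 0] and a level
    [level j] that is [n] up to a logarithm; it takes the value [V] at large
    primes.  The factor [S] ([selberg_sum]) is Selberg's sum for the primes above
    [level j]; it takes the value [h] at large primes.  Both are combinations of the
    functions [ram U], which are Ramanujan sums up to sign, divided by the totient
    of their modulus.  Expanding, [L S^2 = h (L + selberg_rest)], and
    [L = 1 + sum over i < j of rough_step i].  So the average over primes is at
    most of order [a^2] times the sum of three kinds of averages.

    - The constant [1] gives the ordinary averages, controlled at all scales at
      once by the maximal ergodic inequality ([maximal_ergodic]), with threshold
      of order [lambda / a^2].

    - The functions [ram U] with different [U] multiply to functions of mean
      zero over a period.  Hence the corresponding averaging operators are almost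
      orthogonal, and the operator norm of a combination is governed by its
      largest term and not by the sum of its terms
      ([almost_orthogonal_sum_le]).  A combination of moduli above [s^2] thus has
      operator norm at most of order [s^(-3/2)] ([sqnorm_ram_expansion_le]).  For
      the rest of Selberg's sum at level [j] the squares of these norms remain
      summable over all the dyadic scales attached to the level, so each scale is
      treated separately with Chebyshev's inequality.

    - [rough_step i] is periodic, and the windows of averaging are chosen as
      multiples of its period.  Its averages are then ordinary averages, along
      steps of one period, of a single function of small norm, and the maximal
      ergodic inequality applies again ([periodic_maximal_count]).

    All the operators involve only the translations by multiples of [1], so the
    counting is done in a finite cyclic group into which the finitely many
    relevant integers embed ([transference]). *)

Set Implicit Arguments.
Unset Strict Implicit.
Unset Printing Implicit Defensive.

Import Order.TTheory GRing.Theory Num.Theory.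

Local Open Scope ring_scope.

(** * The maximal ergodic inequality *)

Section Maximal.
Variables (R : realFieldType) (G : finZmodType).
Implicit Types (f : G -> R) (g x : G) (t : R).

Lemma sum_translate (f : G -> R) (g : G) : \sum_x f (x + g) = \sum_x f x.
Proof. by rewrite [RHS](reindex_inj (addIr g)). Qed.

(** The maximum over [m <= k] of the sums of [f - t] over [m] steps of the orbit
    of [x]. The recursion on the first step is what the proof of the maximal
    inequality uses. *)
Fixpoint maxsum f g t k x : R :=
  if k is k'.+1 then Num.max 0 (f x - t + maxsum f g t k' (x + g)) else 0.

Lemma maxsum_ge0 f g t k x : 0 <= maxsum f g t k x.
Proof. by case: k => //= k; rewrite le_max lexx. Qed.

Lemma maxsum_mono f g t k x : maxsum f g t k x <= maxsum f g t k.+1 x.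
Proof.
elim: k x => [|k IH] x; first exact: maxsum_ge0.
rewrite /= ge_max le_max lexx /= le_max.
by apply/orP; right; rewrite lerD2l; apply: IH.
Qed.

Lemma maxsum_ge f g t k m x : (m <= k)%N ->
  \sum_(0 <= i < m) (f (x + g *+ i) - t) <= maxsum f g t k x.
Proof.
elim: k m x => [|k IH] [|m] x // le_mk; try by rewrite big_geq ?maxsum_ge0.
rewrite big_nat_recl // mulr0n addr0 /= le_max; apply/orP; right.
rewrite lerD2l; apply: le_trans (IH m (x + g) le_mk).
by rewrite ler_sum // => i _; rewrite mulrS addrA.
Qed.

(** Garsia's argument. Where the maximum [M] of the partial sums of [f - t] is
    positive, [f x - t] is at least [M x - M (x + g)]; elsewhere [M] vanishes. As
    translations preserve sums, the sum of [f - t] over [M > 0] is nonnegative. *)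
Lemma maximal_ergodic f g t K : (forall x, 0 <= f x) -> 0 <= t ->
  t * #|[set x | [exists m : 'I_K, t * m.+1%:R < \sum_(0 <= i < m.+1) f (x + g *+ i)]]|%:R
    <= \sum_x f x.
Proof.
move=> f_ge0 t_ge0.
pose M := maxsum f g t K.
have key : 0 <= \sum_(x | 0 < M x) (f x - t).
  have step x : 0 < M x -> M x - M (x + g) <= f x - t.
    rewrite /M; case: (K) => [|k]; first by rewrite ltxx.
    have := maxsum_mono f g t k (x + g); set y := maxsum _ _ _ k.+1 (x + g).
    move=> mono /=; rewrite lt_max ltxx /= => pos.
    rewrite max_r ?(ltW pos) //; lra.
  apply: le_trans (ler_sum _ step); rewrite sumrB subr_ge0.
  apply: (@le_trans _ _ (\sum_x M (x + g))).
    rewrite [leRHS](bigID (fun x => 0 < M x)) /= lerDl sumr_ge0 // => x _.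
    exact: maxsum_ge0.
  rewrite sum_translate (bigID (fun x => 0 < M x)) /= gerDl.
  by rewrite sumr_le0 // => x; rewrite -leNgt.
set A := [set x | _].
have sub : {subset A <= [pred x | 0 < M x]}.
  move=> x; rewrite !inE => /existsP[m] lt_m.
  apply: lt_le_trans (maxsum_ge f g t x (ltn_ord m)).
  by rewrite sumrB sumr_const_nat subn0 subr_gt0 -mulr_natr.
rewrite sumrB subr_ge0 sumr_const -mulr_natr in key.
apply: (@le_trans _ _ (t * #|[pred x | 0 < M x]|%:R)).
  by rewrite ler_wpM2l // ler_nat subset_leq_card //; apply/subsetP.
apply: le_trans key _; rewrite [leRHS](bigID (fun x => 0 < M x)) /= lerDl.
exact: sumr_ge0.
Qed.

End Maximal.

(** * Almost orthogonality *)

Section SquareNorm.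
Variables (R : realFieldType) (X : finType).
Implicit Types (phi psi : X -> R).

Definition inner phi psi := \sum_x phi x * psi x.
Definition sqnorm phi := \sum_x phi x ^+ 2.

Lemma sqnorm_ge0 phi : 0 <= sqnorm phi.
Proof. by apply: sumr_ge0 => x _; apply: sqr_ge0. Qed.

Lemma inner_self phi : inner phi phi = sqnorm phi.
Proof. by apply: eq_bigr => x _; rewrite expr2. Qed.

(** Cauchy-Schwarz in the form that needs no square root: the free weight [c] is
    optimized by the caller. *)
Lemma inner_le phi psi c : 0 < c ->
  `|inner phi psi| <= (c * sqnorm phi + c^-1 * sqnorm psi) / 2.
Proof.
move=> c_gt0; rewrite /inner /sqnorm !mulr_sumr -big_split /= mulr_suml.
apply: le_trans (ler_norm_sum _ _ _) _; apply: ler_sum => x _.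
rewrite normrM -(real_normK (num_real (phi x))) -(real_normK (num_real (psi x))).
have -> : c * `|phi x| ^+ 2 = c^-1 * (c * `|phi x|) ^+ 2.
  by field; rewrite gt_eqF.
have -> : `|phi x| * `|psi x| = c^-1 * (c * `|phi x| * `|psi x|).
  by field; rewrite gt_eqF.
rewrite -mulrDr -[leRHS]mulrA ler_wpM2l ?invr_ge0 ?(ltW c_gt0) //.
move: (c * `|phi x|) `|psi x| => u v; have := sqr_ge0 (u - v); nra.
Qed.

Lemma inner_sumr (I : Type) (r : seq I) phi (v : I -> X -> R) :
  inner phi (fun x => \sum_(i <- r) v i x) = \sum_(i <- r) inner phi (v i).
Proof.
by rewrite /inner exchange_big /=; apply: eq_bigr => x _; rewrite mulr_sumr.
Qed.

Lemma innerC phi psi : inner phi psi = inner psi phi.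
Proof. by apply: eq_bigr => x _; rewrite mulrC. Qed.

Lemma innerZ c phi psi : inner phi (fun x => c * psi x) = c * inner phi psi.
Proof. by rewrite /inner mulr_sumr; apply: eq_bigr => x _; rewrite mulrCA. Qed.

Lemma sqnormZ c phi : sqnorm (fun x => c * phi x) = c ^+ 2 * sqnorm phi.
Proof. by rewrite /sqnorm mulr_sumr; apply: eq_bigr => x _; rewrite exprMn. Qed.

Lemma sqnorm_sum_le (I : eqType) (r : seq I) (v : I -> X -> R) (w : I -> R) E :
  uniq r -> 0 <= E ->
  {in r &, forall i j, i != j -> `|inner (v i) (v j)| <= `|w i| * `|w j| * E} ->
  sqnorm (fun x => \sum_(i <- r) v i x)
    <= \sum_(i <- r) sqnorm (v i) + (\sum_(i <- r) `|w i|) ^+ 2 * E.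
Proof.
move=> Ur E0 H; rewrite -inner_self inner_sumr expr2 mulr_sumr mulr_suml -big_split /=.
rewrite big_seq [leRHS]big_seq; apply: ler_sum => i ir.
rewrite innerC inner_sumr (bigD1_seq i) //= inner_self lerD2l.
rewrite mulr_suml [in leRHS]mulr_suml [leRHS](bigD1_seq i) //=.
apply: ler_wpDl; first by rewrite !mulr_ge0.
rewrite big_seq_cond [leRHS]big_seq_cond; apply: ler_sum => j /andP[jr ji].
apply: le_trans (ler_norm _) _; apply: le_trans (H i j ir jr _) _ => //.
  by rewrite eq_sym.
by rewrite [ `|w i| * _]mulrC.
Qed.

(** Let [v i = w i T_i phi] and let [S] be the sum of the squared norms of the
    [v i]. Up to the cross terms, [S] is the squared norm of the sum. Moreover
    [S] is the inner product of [phi] with [u], the sum of the [w i T'_i (v i)],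
    and almost orthogonality of the adjoints bounds the squared norm of [u] by
    about [kappa * S]. Hence [S] is at most about [kappa] times the squared norm
    of [phi]: only the largest of the operators counts. *)
Lemma almost_orthogonal_sum_le (I : eqType) (r : seq I) (w : I -> R)
    (T T' : I -> (X -> R) -> X -> R) kappa eps phi :
  uniq r -> 0 < kappa -> 0 <= eps ->
  (forall i phi psi, inner (T i phi) psi = inner phi (T' i psi)) ->
  {in r, forall i psi, w i ^+ 2 * sqnorm (T' i psi) <= kappa * sqnorm psi} ->
  {in r &, forall i j, i != j -> forall phi psi,
     `|inner (T i phi) (T j psi)| <= eps * ((sqnorm phi + sqnorm psi) / 2)} ->
  {in r &, forall i j, i != j -> forall phi psi,
     `|inner (T' i phi) (T' j psi)| <= eps * ((sqnorm phi + sqnorm psi) / 2)} ->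
  sqnorm (fun x => \sum_(i <- r) w i * T i phi x)
    <= (kappa + 2 * (eps * (\sum_(i <- r) `|w i|) ^+ 2)) * sqnorm phi.
Proof.
move=> Ur k0 e0 adj diag offT offT'.
set W := \sum_(i <- r) `|w i|.
pose v i x := w i * T i phi x.
pose S := \sum_(i <- r) sqnorm (v i).
have first : sqnorm (fun x => \sum_(i <- r) v i x) <= S + W ^+ 2 * (eps * sqnorm phi).
  apply: sqnorm_sum_le => // [|i j ir jr ij]; first by rewrite mulr_ge0 ?sqnorm_ge0.
  rewrite innerZ innerC innerZ mulrA !normrM innerC [ `|w j| * _]mulrC ler_wpM2l ?mulr_ge0 //.
  apply: le_trans (offT i j ir jr ij _ _) _; rewrite ler_wpM2l //; lra.
(* Duality: estimating [u] is Bessel's inequality for the adjoints. *)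
pose u x := \sum_(i <- r) w i * T' i (v i) x.
have SE : S = inner phi u.
  rewrite inner_sumr; apply: eq_bigr => i _.
  by rewrite innerZ -adj -inner_self innerC innerZ innerC.
have S0 : 0 <= S by apply: sumr_ge0 => i _; apply: sqnorm_ge0.
have nS i : i \in r -> sqnorm (v i) <= S.
  move=> ir; rewrite /S (bigD1_seq i) //= lerDl.
  by apply: sumr_ge0 => j _; apply: sqnorm_ge0.
have second : sqnorm u <= (kappa + eps * W ^+ 2) * S.
  have -> : (kappa + eps * W ^+ 2) * S = kappa * S + W ^+ 2 * (eps * S) by ring.
  apply: le_trans (@sqnorm_sum_le _ r (fun i x => w i * T' i (v i) x) w (eps * S) Ur _ _) _.
  - by rewrite mulr_ge0.
  - move=> i j ir jr ij.
    rewrite innerZ innerC innerZ mulrA !normrM innerC [ `|w j| * _]mulrC ler_wpM2l ?mulr_ge0 //.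
    apply: le_trans (offT' i j ir jr ij _ _) _; rewrite ler_wpM2l //.
    have := nS i ir; have := nS j jr; lra.
  - rewrite lerD2r.
    rewrite /S mulr_sumr big_seq [leRHS]big_seq; apply: ler_sum => i ir.
    by rewrite sqnormZ; apply: diag.
have kW : 0 < kappa + eps * W ^+ 2.
  by apply: ltr_wpDr => //; rewrite mulr_ge0 ?sqr_ge0.
(* [S] occurs on both sides; the weight in [inner_le] leaves half of it. *)
have SS : S <= (kappa + eps * W ^+ 2) * sqnorm phi.
  have := inner_le phi u kW; rewrite -SE ger0_norm // => le1.
  have : (kappa + eps * W ^+ 2)^-1 * sqnorm u <= S.
    by rewrite mulrC ler_pdivrMr // mulrC.
  lra.
apply: le_trans first _; move: SS; rewrite !mulrDl; lra.
Qed.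

End SquareNorm.

(** * Sums of periodic functions *)

Section PeriodicSums.
Variable R : realFieldType.
Implicit Types (F : nat -> R).

Lemma periodic_mul F d : (forall n, F (n + d)%N = F n) ->
  forall k n, F (n + k * d)%N = F n.
Proof.
by move=> per; elim=> [|k IH] n; rewrite ?addn0 // mulSn addnCA addnC per IH.
Qed.

Lemma sum_blocks F m d :
  \sum_(0 <= n < m * d) F n = \sum_(0 <= t < m) \sum_(0 <= i < d) F (i + t * d)%N.
Proof.
rewrite big_nat_mul; apply: eq_bigr => t _.
by rewrite -[X in \sum_(X <= _ < _) _]add0n big_addn mulSn addnK.
Qed.

Lemma sum_residues F p d i : (0 < p)%N -> coprime p d ->
  (forall n, F (n + p)%N = F n) ->
  \sum_(0 <= t < p) F (i + t * d)%N = \sum_(0 <= t < p) F t.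
Proof.
move=> p0 cop per; rewrite !big_mkord.
pose h (t : 'I_p) := Ordinal (ltn_pmod (i + t * d) p0).
have inj : injective h.
  suff W (t u : 'I_p) : (t <= u)%N -> h t = h u -> t = u.
    move=> t u; case/orP: (leq_total t u) => le_tu E; first exact: W.
    by apply/esym/W.
  move=> le_tu /(congr1 val) /= /eqP.
  rewrite eqn_modDl eq_sym eqn_mod_dvd ?leq_mul2r ?le_tu ?orbT // -mulnBl.
  rewrite Gauss_dvdl // => /dvdn_leq dl; apply: val_inj => /=.
  have := ltn_ord u; have := ltn_ord t; lia.
rewrite [RHS](reindex_inj inj) /=; apply: eq_bigr => t _.
by rewrite {1}(divn_eq (i + t * d) p) addnC periodic_mul.
Qed.

(** Split [n] as [i + t d] with [i < d]. Then [G] depends only on [i], while for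
    fixed [i] the argument of [F] runs through all the residues modulo [p]. *)
Lemma sum_zero_mean F G p d : (0 < p)%N -> coprime p d ->
  (forall n, F (n + p)%N = F n) -> (forall n, G (n + d)%N = G n) ->
  \sum_(0 <= t < p) F t = 0 ->
  \sum_(0 <= n < p * d) F n * G n = 0.
Proof.
move=> p0 cop perF perG F0; rewrite sum_blocks exchange_big /=.
rewrite big1 // => i _.
under eq_bigr => t _ do rewrite (periodic_mul perG).
by rewrite -mulr_suml sum_residues // F0 mul0r.
Qed.

Lemma sum_periodic F d k : (forall n, F (n + d)%N = F n) ->
  \sum_(0 <= n < k * d) F n = k%:R * \sum_(0 <= n < d) F n.
Proof.
move=> per; rewrite sum_blocks mulr_natl -[k in RHS]subn0 -sumr_const_nat.
by apply: eq_bigr => t _; apply: eq_bigr => i _; rewrite periodic_mul.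
Qed.

(** Complete periods cancel, and fewer than [d] terms are left. *)
Lemma zero_mean_partial_sum_le F d M : (0 < d)%N ->
  (forall n, F (n + d)%N = F n) -> \sum_(0 <= n < d) F n = 0 ->
  (forall n, `|F n| <= 1) -> `|\sum_(0 <= n < M) F n| <= d%:R.
Proof.
move=> d0 per F0 F1; rewrite {1}(divn_eq M d).
rewrite (@big_cat_nat _ _ _ (M %/ d * d)) ?leq_addr //= sum_periodic //.
rewrite F0 mulr0 add0r; apply: le_trans (ler_norm_sum _ _ _) _.
apply: le_trans (ler_sum _ (fun n _ => F1 n)) _.
rewrite sumr_const_nat addKn ler_nat; exact/ltnW/ltn_pmod.
Qed.

Lemma abs_average_le F d M : (0 < d)%N -> (d <= M)%N ->
  (forall n, F (n + d)%N = F n) ->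
  M%:R^-1 * \sum_(0 <= n < M) `|F n| <= 2 * (d%:R^-1 * \sum_(0 <= n < d) `|F n|).
Proof.
move=> d0 dM per.
have M0 : (0 < M)%N by exact: leq_trans dM.
have leS : \sum_(0 <= n < M) `|F n| <= (M %/ d).+1%:R * \sum_(0 <= n < d) `|F n|.
  rewrite -sum_periodic; last by move=> n; rewrite per.
  rewrite [leRHS](@big_cat_nat _ _ _ M) //=; last by rewrite ltnW // ltn_ceil.
  by rewrite lerDl sumr_ge0.
rewrite mulrC ler_pdivrMr ?ltr0n //; apply: le_trans leS _.
have -> (x y z : R) : 2 * (x * y) * z = 2 * z * x * y by ring.
rewrite ler_wpM2r ?sumr_ge0 // ler_pdivlMr ?ltr0n // -!natrM ler_nat.
have := leq_trunc_div M d; rewrite mulSn; lia.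
Qed.

Lemma sum_triangle (F : nat -> nat -> R) N e :
  \sum_(0 <= n < N) \sum_(n + e <= m < N) F n m
  = \sum_(0 <= h < N) \sum_(0 <= n < N - (h + e)) F n (n + (h + e))%N.
Proof.
transitivity (\sum_(0 <= n < N) \sum_(0 <= h < N | (n + (h + e) < N)%N) F n (n + (h + e))%N).
  apply: eq_big_nat => n nN.
  rewrite -[X in \sum_(X <= _ < _) _]add0n big_addn.
  rewrite (big_nat_widen _ _ N) ?leq_subr //.
  by apply: eq_big => [h|h _]; [lia | congr F; lia].
rewrite (exchange_big_dep_nat predT) //=; apply: eq_bigr => h _.
rewrite [RHS](big_nat_widen _ _ N) ?leq_subr //.
by apply: eq_bigl => n; lia.
Qed.

(** Read along its diagonals, a double sum over pairs of shifts becomes a sum over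
    the difference of the shifts, where correlations appear. *)
Lemma double_sum_diagonals (F : nat -> nat -> R) N :
  \sum_(0 <= n < N) \sum_(0 <= m < N) F n m
  = \sum_(0 <= h < N) \sum_(0 <= n < N - h) F n (n + h)%N
    + \sum_(0 <= h < N) \sum_(0 <= n < N - h.+1) F (n + h.+1)%N n.
Proof.
have := sum_triangle F N 0; under [X in _ = X -> _]eq_bigr do rewrite addn0.
move=> <-; have := sum_triangle (fun m n => F n m) N 1.
under [X in _ = X -> _]eq_bigr do rewrite addn1.
move=> <-.
have -> : \sum_(0 <= n < N) \sum_(n + 1 <= m < N) F m n
   = \sum_(0 <= m < N) \sum_(0 <= n < m) F m n.
  transitivity (\sum_(0 <= n < N) \sum_(0 <= m < N | (n < m)%N) F m n).
    apply: eq_big_nat => n nN; rewrite (big_nat_widenl _ 0) //.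
    by apply: eq_bigl => m; rewrite addn1.
  rewrite (exchange_big_dep_nat predT) //=; apply: eq_big_nat => m mN.
  by rewrite [RHS](big_nat_widen _ _ N) ?(ltnW mN) //; case/andP: mN => _ /ltnW.
rewrite -big_split /=; apply: eq_big_nat => n nN.
rewrite addn0 addrC -big_cat_nat //; by case/andP: nN => _ /ltnW.
Qed.

End PeriodicSums.

(** * Weighted sums along an orbit *)

Section Convolution.
Variables (R : realFieldType) (G : finZmodType).
Implicit Types (phi psi : G -> R) (a b k : nat -> R) (g : G).

Definition orbit_sum k N g phi x := \sum_(0 <= n < N) k n * phi (x + g *+ n).

Lemma orbit_sum_adjoint k N g phi psi :
  inner (orbit_sum k N g phi) psi = inner phi (orbit_sum k N (- g) psi).
Proof.
rewrite /inner /orbit_sum.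
under eq_bigr do rewrite mulr_suml.
under [RHS]eq_bigr do rewrite mulr_sumr.
rewrite exchange_big [RHS]exchange_big /=; apply: eq_bigr => n _.
rewrite -[RHS](sum_translate _ (g *+ n)); apply: eq_bigr => x _.
rewrite mulNrn addrK; ring.
Qed.

Lemma sqnorm_orbit_sum_le k N g phi :
  sqnorm (orbit_sum k N g phi) <= (\sum_(0 <= n < N) `|k n|) ^+ 2 * sqnorm phi.
Proof.
set K := \sum_(_ <= _ < _) _.
have pt x : orbit_sum k N g phi x ^+ 2 <= K * \sum_(0 <= n < N) `|k n| * phi (x + g *+ n) ^+ 2.
  set u := fun n => phi (x + g *+ n).
  have E1 : K * \sum_(0 <= n < N) `|k n| * u n ^+ 2 =
    \sum_(0 <= n < N) \sum_(0 <= m < N) `|k n| * `|k m| * ((u n ^+ 2 + u m ^+ 2) / 2).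
    set B := (X in K * X = _).
    transitivity ((B * K + K * B) / 2); first by field.
    rewrite /B /K !big_distrlr -big_split /= mulr_suml; apply: eq_bigr => n _.
    rewrite -big_split /= mulr_suml; by apply: eq_bigr => m _; field.
  rewrite E1 expr2 big_distrlr /=; apply: ler_sum => n _; apply: ler_sum => m _.
  apply: le_trans (ler_norm _) _.
  rewrite mulrACA normrM -[X in _ <= X * _]normrM ler_wpM2l //.
  rewrite normrM -(real_normK (num_real (u n))) -(real_normK (num_real (u m))).
  by move: (`|u n|) (`|u m|) => v w; have := sqr_ge0 (v - w); nra.
apply: le_trans (ler_sum _ (fun x _ => pt x)) _.
rewrite -mulr_sumr exchange_big /= expr2 -mulrA ler_wpM2l ?sumr_ge0 //.
rewrite mulr_suml; apply: ler_sum => n _.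
by rewrite -mulr_sumr (sum_translate (fun x => phi x ^+ 2)).
Qed.

(** The inner product of two translates of [phi] and [psi] depends only on the
    difference of the translations. Each of the at most [2 N] differences costs
    at most one correlation of the weights. *)
Lemma inner_orbit_sum_le a b N g phi psi (E : R) :
  (forall M h, `|\sum_(0 <= n < M) a n * b (n + h)%N| <= E) ->
  (forall M h, `|\sum_(0 <= n < M) a (n + h)%N * b n| <= E) ->
  `|inner (orbit_sum a N g phi) (orbit_sum b N g psi)|
    <= 2 * N%:R * E * ((sqnorm phi + sqnorm psi) / 2).
Proof.
move=> Eab Eba.
pose C n m := \sum_x phi (x + g *+ n) * psi (x + g *+ m).
have E0 : 0 <= E by apply: le_trans (Eab 0%N 0%N).
set S := _ / 2; have S0 : 0 <= S by rewrite /S divr_ge0 ?addr_ge0 ?sqnorm_ge0.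
have CS n m : `|C n m| <= S.
  have := inner_le (fun x => phi (x + g *+ n)) (fun x => psi (x + g *+ m)) ltr01.
  rewrite /sqnorm (sum_translate (fun x => phi x ^+ 2)) (sum_translate (fun x => psi x ^+ 2)).
  by rewrite invr1 !mul1r.
have shift n i j : C (i + n)%N (j + n)%N = C i j.
  rewrite /C -[RHS](sum_translate _ (g *+ n)); apply: eq_bigr => x _.
  by rewrite -!addrA -!mulrnDr ![(n + _)%N]addnC.
have C1 n h : C n (n + h)%N = C 0%N h by rewrite -(shift n 0%N h) add0n addnC.
have C2 n h : C (n + h)%N n = C h 0%N by rewrite -(shift n h 0%N) add0n addnC.
have -> : inner (orbit_sum a N g phi) (orbit_sum b N g psi)
   = \sum_(0 <= n < N) \sum_(0 <= m < N) a n * b m * C n m.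
  rewrite /inner /orbit_sum; under eq_bigr do rewrite big_distrlr /=.
  rewrite exchange_big /=; apply: eq_bigr => n _.
  rewrite exchange_big /=; apply: eq_bigr => m _.
  by rewrite mulr_sumr; apply: eq_bigr => x _; ring.
have part F : (forall h, `|F h| <= E * S) ->
    `|\sum_(0 <= h < N) F h| <= N%:R * (E * S).
  move=> H; apply: le_trans (ler_norm_sum _ _ _) _.
  apply: le_trans (ler_sum _ (fun h _ => H h)) _.
  by rewrite sumr_const_nat subn0 mulr_natl.
rewrite double_sum_diagonals; apply: le_trans (ler_normD _ _) _.
have -> : 2 * N%:R * E * S = N%:R * (E * S) + N%:R * (E * S) by ring.
apply: lerD; apply: part => h.
  under eq_bigr => n _ do rewrite C1.
  by rewrite -mulr_suml normrM ler_pM.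
under eq_bigr => n _ do rewrite C2.
by rewrite -mulr_suml normrM ler_pM.
Qed.

End Convolution.

(** * Normalized Ramanujan sums *)

Definition prodn (U : seq nat) : nat := (\prod_(p <- U) p)%N.

Fixpoint subseqs (l : seq nat) : seq (seq nat) :=
  if l is p :: l' then subseqs l' ++ [seq p :: U | U <- subseqs l'] else [:: [::]].

Lemma subseqs_subseq l U : U \in subseqs l -> subseq U l.
Proof.
elim: l U => [|p l IH] U; first by rewrite inE => /eqP->.
rewrite [subseqs _]/= mem_cat => /orP[/IH sub|/mapP[V /IH sub ->]]; last by rewrite /= eqxx.
by apply: subseq_trans sub _; apply: subseq_cons.
Qed.

Lemma mem_subseqs_nil l : [::] \in subseqs l.
Proof. by elim: l => //= p l IH; rewrite mem_cat IH. Qed.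

Lemma subseqs_uniq l : uniq l -> uniq (subseqs l).
Proof.
elim: l => [|p l IH] //= /andP[pl /IH Ul].
rewrite cat_uniq Ul map_inj_uniq ?Ul ?andbT //=; last by move=> U V [].
apply/hasPn => _ /mapP[V _ ->]; apply/negP => /subseqs_subseq /mem_subseq.
by move=> /(_ p (mem_head _ _)); apply/negP.
Qed.

Lemma subseqs_mem_inj l U V : uniq l -> U \in subseqs l -> V \in subseqs l ->
  U =i V -> U = V.
Proof.
move=> Ul /subseqs_subseq sU /subseqs_subseq sV UV.
move/(subseq_uniqP Ul): sU => ->; move/(subseq_uniqP Ul): sV => ->.
by apply: eq_in_filter => x _ /=; rewrite UV.
Qed.

Lemma prime_dvd_prodn p U : prime p -> all prime U -> (p %| prodn U)%N = (p \in U).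
Proof.
move=> pp /allP aU; apply/idP/idP => [|pU].
  rewrite Euclid_dvd_prod // big_has => /hasP[q qU].
  by rewrite (dvdn_prime2 pp (aU _ qU)) => /eqP->.
by rewrite /prodn (big_rem p) //= dvdn_mulr.
Qed.

Lemma prodn_gt0 U : all prime U -> (0 < prodn U)%N.
Proof. by move=> /allP aU; rewrite /prodn big_seq prodn_cond_gt0 // => p /aU/prime_gt0. Qed.

Lemma prodn_inj l U V : uniq l -> all prime l -> U \in subseqs l -> V \in subseqs l ->
  prodn U = prodn V -> U = V.
Proof.
move=> Ul al sU sV UV; apply: (subseqs_mem_inj Ul) => // p.
have al' W : W \in subseqs l -> all prime W.
  by move=> /subseqs_subseq /mem_subseq sub; apply/allP => q /sub; apply: (allP al).
case pp : (prime p); first by rewrite -!prime_dvd_prodn ?al' ?UV.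
by apply/idP/idP => [/(allP (al' _ sU))|/(allP (al' _ sV))]; rewrite pp.
Qed.

Section RamanujanSums.
Variable R : realFieldType.

Definition ram1 (p n : nat) : R := if (p %| n)%N then -1 else p.-1%:R^-1.
(** For the squarefree modulus [q] with set of primes [U], this is
    [mu(q) c_q(n) / phi(q)] where [c_q] is the Ramanujan sum. With this
    normalization [1 + ram1 p] is the sieve factor of [p], equal to [0] at
    multiples of [p] and to [p / (p - 1)] elsewhere. *)
Definition ram (U : seq nat) (n : nat) : R := \prod_(p <- U) ram1 p n.

Lemma ram1_periodic p d n : (p %| d)%N -> ram1 p (n + d) = ram1 p n.
Proof. by move=> pd; rewrite /ram1 dvdn_addl. Qed.

Lemma ram_periodic U n : ram U (n + prodn U) = ram U n.
Proof.
rewrite /ram big_seq [RHS]big_seq; apply: eq_bigr => p pU.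
by rewrite ram1_periodic // /prodn (big_rem p) //= dvdn_mulr.
Qed.

Lemma ram1_le1 p n : `|ram1 p n| <= 1.
Proof.
rewrite /ram1; case: ifP => _; first by rewrite normrN1.
rewrite ger0_norm ?invr_ge0 //; case: p.-1 => [|k]; first by rewrite invr0.
by rewrite invf_le1 ?ltr0n // ler1n.
Qed.

Lemma ram_le1 U n : `|ram U n| <= 1.
Proof.
rewrite /ram; apply: (big_ind (fun x => `|x| <= 1)) => [|x y x1 y1|p _];
    rewrite ?normr1 ?ram1_le1 //.
by rewrite normrM mulr_ile1.
Qed.

Lemma sum_ram1 (f : R -> R) p : prime p ->
  \sum_(0 <= t < p) f (ram1 p t) = f (-1) + p.-1%:R * f p.-1%:R^-1.
Proof.
move=> /prime_gt1 p1; rewrite big_ltn ?(ltnW p1) // {1}/ram1 dvdn0; congr (_ + _).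
rewrite (eq_big_nat _ _ (F2 := fun _ => f p.-1%:R^-1)); last first.
  by move=> t /andP[t0 tp]; rewrite /ram1 gtnNdvd.
by rewrite sumr_const_nat subn1 mulr_natl.
Qed.

Lemma sum_ram1_eq0 p : prime p -> \sum_(0 <= t < p) ram1 p t = 0.
Proof.
move=> pp; rewrite (sum_ram1 id) // mulfV ?addNr // pnatr_eq0.
by have := prime_gt1 pp; lia.
Qed.

(** By the Chinese remainder theorem the sum is a product over the primes of [U],
    and each prime contributes [1 + (p - 1) / (p - 1) = 2]. *)
Lemma sum_abs_ram U : uniq U -> all prime U ->
  \sum_(0 <= n < prodn U) `|ram U n| = 2 ^+ size U.
Proof.
elim: U => [|p U IH] /=; first by rewrite /prodn big_nil big_nat1 /ram big_nil normr1.
move=> /andP[pU Uu] /andP[pp aU].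
have cop : coprime p (prodn U) by rewrite prime_coprime // prime_dvd_prodn.
rewrite {1}/prodn big_cons -/(prodn U) sum_blocks exchange_big /=.
rewrite exprS -IH // mulr_sumr; apply: eq_bigr => i _.
under eq_bigr => t _.
  rewrite /ram big_cons -/(ram U _) normrM (periodic_mul (ram_periodic U)).
  over.
rewrite -mulr_suml (sum_residues (F := fun t => `|ram1 p t|)) ?prime_gt0 //; last first.
  by move=> n; rewrite ram1_periodic.
rewrite (sum_ram1 (fun x => `|x|)) // /= normrN1 [ `|_^-1|]ger0_norm ?invr_ge0 // mulfV //.
by rewrite pnatr_eq0; have := prime_gt1 pp; lia.
Qed.

(** The prime [p] divides the modulus of the first factor only, so over each
    complete period the zero mean of [ram1 p] makes the product cancel. *)
Lemma ram_correlation_aux U V p h i M : all prime U -> all prime V -> uniq U ->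
  p \in U -> p \notin V ->
  `|\sum_(0 <= n < M) ram U (n + h)%N * ram V (n + i)%N| <= (prodn U * prodn V)%:R.
Proof.
move=> aU aV Uu pU pV.
have pp := allP aU _ pU.
have EU : prodn U = (p * prodn (rem p U))%N by rewrite /prodn (big_rem p).
have pU' : p \notin rem p U by rewrite mem_rem_uniqF.
have aU' : all prime (rem p U).
  by apply/allP => q /mem_rem; apply: (allP aU).
apply: zero_mean_partial_sum_le.
- by rewrite muln_gt0 !prodn_gt0.
- move=> n; rewrite -!addnA [(_ + h)%N]addnC [(_ + i)%N]addnC !addnA.
  rewrite [(prodn U * _)%N in X in _ * X]mulnC {1}[(prodn U * _)%N]mulnC.
  rewrite (periodic_mul (ram_periodic _)).
  by rewrite mulnC (periodic_mul (ram_periodic _)).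
- rewrite EU -mulnA.
  under eq_bigr => n _.
    rewrite {1}/ram (big_rem p) //= -/(ram (rem p U) _) -mulrA.
    over.
  apply: (sum_zero_mean (F := fun n => ram1 p (n + h)%N)
     (G := fun n => ram (rem p U) (n + h)%N * ram V (n + i)%N)).
  + exact: prime_gt0.
  + by rewrite coprimeMr !prime_coprime // !prime_dvd_prodn // pU' pV.
  + by move=> n; rewrite addnAC ram1_periodic.
  + move=> n; rewrite addnAC [in ram V _]addnAC (periodic_mul (ram_periodic _)).
    by rewrite mulnC (periodic_mul (ram_periodic _)).
  + rewrite -[RHS](sum_ram1_eq0 pp).
    have := @sum_residues _ (ram1 p) p 1 h (prime_gt0 pp) (coprimen1 p).
    move=> <-; last by move=> n; rewrite ram1_periodic.
    by apply: eq_bigr => t _; rewrite muln1 addnC.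
- by move=> n; rewrite normrM mulr_ile1 ?ram_le1.
Qed.

Lemma ram_correlation l U V h i M : all prime l -> uniq l ->
  U \in subseqs l -> V \in subseqs l -> U != V ->
  `|\sum_(0 <= n < M) ram U (n + h)%N * ram V (n + i)%N| <= (prodn U * prodn V)%:R.
Proof.
move=> al Ul sU sV UV.
have al' W : W \in subseqs l -> all prime W.
  by move=> /subseqs_subseq /mem_subseq sub; apply/allP => q /sub; apply: (allP al).
have ul' W : W \in subseqs l -> uniq W by move=> /subseqs_subseq/subseq_uniq; apply.
have [/hasP[p pU pV]|UsubV] := boolP (has (fun p => p \notin V) U).
  by apply: (ram_correlation_aux _ _ _ _ _ _ pU pV); auto.
have [/hasP[p pV pU]|VsubU] := boolP (has (fun p => p \notin U) V).
  rewrite mulnC; under eq_bigr do rewrite mulrC.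
  by apply: (ram_correlation_aux _ _ _ _ _ _ pV pU); auto.
case/eqP: UV; apply: (subseqs_mem_inj Ul) => // p.
by apply/idP/idP => [/(hasPn UsubV)|/(hasPn VsubU)]; rewrite negbK.
Qed.

End RamanujanSums.

(** * The norm of a Ramanujan expansion *)

Lemma prodn_ge_exp c U : all (leq c) U -> (c ^ size U <= prodn U)%N.
Proof.
elim: U => [|p U IH] /=; first by rewrite /prodn big_nil.
by move=> /andP[cp /IH le]; rewrite /prodn big_cons expnS leq_mul.
Qed.

Section Expansions.
Variables (R : realFieldType).

(** The nonzero coefficients sit at moduli in the interval from [y] (excluded) to
    [D]. The growth [3 ^ size U] is what squaring a sum of Ramanujan sums produces:
    a prime of [U] comes from the first factor, from the second, or from both. *)
Definition ram_expansion (l : seq nat) (B : R) (y D : nat) (f : nat -> R) :=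
  exists w : seq nat -> R,
    (forall n, f n = \sum_(U <- subseqs l) w U * ram R U n) /\
    {in subseqs l, forall U, `|w U| <= B * 3 ^+ size U
                         /\ (w U != 0 -> (y < prodn U <= D)%N)}.

Variable G : finZmodType.

(** The averages of the functions [ram U] are almost orthogonal operators, so only
    the largest coefficient-weighted norm matters. At modulus [q] the squared norm
    of the average of [ram U] is at most [4 * 4^|U| / q^2], which with the
    coefficient gives [4 B^2 36^|U| / q^2]. Since [1296 = 36^2] bounds the primes
    from below, [36^|U|] is at most the square root of [q], and [q > s^2] leaves
    [4 B^2 / s^3]. The incomplete periods contribute an error of order
    [B^2 D^6 / N], which is no larger because [N] is at least [D^8]. *)
Lemma sqnorm_ram_expansion_le (l : seq nat) (B : R) (s D N : nat) (f : nat -> R) (g : G) phi :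
  uniq l -> all prime l -> all (leq 1296) l -> 0 < B -> (0 < s)%N ->
  (s ^ 2 <= D)%N -> (D ^ 8 <= N)%N -> ram_expansion l B (s ^ 2) D f ->
  sqnorm (fun x => N%:R^-1 * orbit_sum f N g phi x) <= 8 * B ^+ 2 / s%:R ^+ 3 * sqnorm phi.
Proof.
move=> Ul al l1296 B0 s0 sD DN [w [fE wB]].
have D0 : (0 < D)%N by apply: leq_trans sD; rewrite expn_gt0 s0.
have N0 : (0 < N)%N by apply: leq_trans DN; rewrite expn_gt0 D0.
have N0' : 0 < N%:R :> R by rewrite ltr0n.
have s0' : 0 < s%:R :> R by rewrite ltr0n.
have al' U : U \in subseqs l -> all prime U.
  by move=> /subseqs_subseq /mem_subseq sub; apply/allP => q /sub; apply: (allP al).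
have ul' U : U \in subseqs l -> uniq U by move=> /subseqs_subseq/subseq_uniq; apply.
have l1296' U : U \in subseqs l -> all (leq 1296) U.
  by move=> /subseqs_subseq /mem_subseq sub; apply/allP => q /sub; apply: (allP l1296).
pose r := [seq U <- subseqs l | w U != 0].
have Ur : uniq r by rewrite filter_uniq // subseqs_uniq.
have rP U : U \in r -> U \in subseqs l /\ (s ^ 2 < prodn U <= D)%N.
  by rewrite mem_filter => /andP[w0 sU]; case: (wB U sU) => _ /(_ w0).
have rsub U : U \in r -> U \in subseqs l by case/rP.
have rD U : U \in r -> (prodn U <= D)%N by case/rP => _ /andP[].
pose T (h : G) U (psi : G -> R) x := N%:R^-1 * orbit_sum (ram R U) N h psi x.
have EqT x : N%:R^-1 * orbit_sum f N g phi x = \sum_(U <- r) w U * T g U phi x.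
  rewrite /r big_filter [RHS]big_mkcond /= /T /orbit_sum.
  under [in LHS]eq_bigr do rewrite fE mulr_suml.
  rewrite exchange_big /= mulr_sumr; apply: eq_bigr => U _.
  case: eqP => [->|_] /=; first by rewrite big1 ?mulr0 // => n _; rewrite !mul0r.
  rewrite !mulr_sumr; apply: eq_bigr => n _; ring.
have -> : sqnorm (fun x => N%:R^-1 * orbit_sum f N g phi x)
        = sqnorm (fun x => \sum_(U <- r) w U * T g U phi x).
  by apply: eq_bigr => x _; rewrite EqT.
pose kappa : R := 4 * B ^+ 2 / s%:R ^+ 3.
pose eps : R := 2 * D%:R ^+ 2 / N%:R.
have k0 : 0 < kappa by rewrite /kappa divr_gt0 ?mulr_gt0 ?exprn_gt0.
have e0 : 0 <= eps by rewrite /eps divr_ge0 ?mulr_ge0 ?exprn_ge0.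
have off (h : G) : {in r &, forall U V, U != V -> forall phi psi : G -> R,
     `|inner (T h U phi) (T h V psi)| <= eps * ((sqnorm phi + sqnorm psi) / 2)}.
  move=> U V rU rV UV phi1 psi1; rewrite /T innerZ innerC innerZ mulrA innerC normrM.
  rewrite ger0_norm ?mulr_ge0 ?invr_ge0 //.
  have E M (i j : nat) : `|\sum_(0 <= n < M) ram R U (n + i)%N * ram R V (n + j)%N|
       <= D%:R ^+ 2.
    apply: le_trans (ram_correlation _ _ _ _ al Ul (rsub _ rU) (rsub _ rV) UV) _.
    by rewrite natrM expr2 ler_pM ?ler0n ?ler_nat ?rD.
  have E1 M i := E M 0%N i; have E2 M i := E M i 0%N.
  have {}E1 M i : `|\sum_(0 <= n < M) ram R U n * ram R V (n + i)%N| <= D%:R ^+ 2.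
    by apply: le_trans (E1 M i); under [in leRHS]eq_bigr do rewrite addn0.
  have {}E2 M i : `|\sum_(0 <= n < M) ram R U (n + i)%N * ram R V n| <= D%:R ^+ 2.
    by apply: le_trans (E2 M i); under [in leRHS]eq_bigr do rewrite addn0.
  have := inner_orbit_sum_le N h phi1 psi1 E1 E2.
  rewrite -(ler_pM2l (x := N%:R^-1 * N%:R^-1)) ?mulr_gt0 ?invr_gt0 // => le1.
  apply: le_trans le1 _; rewrite le_eqVlt; apply/orP; left; apply/eqP.
  by rewrite /eps; field; rewrite gt_eqF.
(* Distinct [U] have distinct moduli, so there are at most [D] of them. *)
have wsum : \sum_(U <- r) `|w U| <= B * D%:R ^+ 2.
  apply: (@le_trans _ _ (\sum_(U <- r) B * D%:R)).
    rewrite big_seq [leRHS]big_seq; apply: ler_sum => U rU.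
    case: (wB U (rsub U rU)) => le1 _; apply: le_trans le1 _.
    rewrite ler_pM2l // -natrX ler_nat; apply: leq_trans (rD U rU).
    apply: prodn_ge_exp; apply/allP => p /(allP (l1296' _ (rsub _ rU))).
    exact: leq_trans.
  rewrite big_const_seq count_predT iter_addr_0 -[leLHS]mulr_natr.
  rewrite expr2 mulrA ler_wpM2l ?mulr_ge0 ?(ltW B0) // ler_nat.
  rewrite -(size_map prodn) -[leqRHS](size_iota 1); apply: uniq_leq_size.
    rewrite map_inj_in_uniq // => U V rU rV.
    exact: (prodn_inj Ul al (rsub _ rU) (rsub _ rV)).
  move=> _ /mapP[U rU ->]; rewrite mem_iota add1n ltnS rD // andbT.
  exact: prodn_gt0 (al' _ (rsub _ rU)).
have diag : {in r, forall U psi, w U ^+ 2 * sqnorm (T (- g) U psi) <= kappa * sqnorm psi}.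
  move=> U rU psi; rewrite /T sqnormZ.
  have q0 : (0 < prodn U)%N by exact: prodn_gt0 (al' _ (rsub _ rU)).
  have q0' : 0 < (prodn U)%:R :> R by rewrite ltr0n.
  set c := \sum_(0 <= n < N) `|ram R U n|.
  have le1 : N%:R^-1 * c <= 2 * ((prodn U)%:R^-1 * 2 ^+ size U).
    rewrite -(sum_abs_ram R (ul' _ (rsub _ rU)) (al' _ (rsub _ rU))).
    apply: abs_average_le => //; last exact: ram_periodic.
    apply: leq_trans (rD _ rU) _; apply: leq_trans DN.
    by rewrite -{1}(expn1 D) leq_pexp2l.
  have c0 : 0 <= N%:R^-1 * c by rewrite mulr_ge0 ?invr_ge0 ?sumr_ge0.
  have le2 : w U ^+ 2 * (N%:R^-1 * c) ^+ 2 <= kappa.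
    rewrite -exprMn -(real_normK (num_real (_ * _))) normrM (ger0_norm c0).
    case: (wB U (rsub U rU)) => wU _.
    apply: (@le_trans _ _ ((B * 3 ^+ size U * (2 * ((prodn U)%:R^-1 * 2 ^+ size U))) ^+ 2)).
      have Bk0 : 0 <= B * 3 ^+ size U by rewrite mulr_ge0 ?exprn_ge0 ?(ltW B0).
      have q20 : 0 <= 2 * ((prodn U)%:R^-1 * 2 ^+ size U) :> R.
        by rewrite !mulr_ge0 ?exprn_ge0 ?invr_ge0.
      by rewrite lerXn2r ?nnegrE ?(mulr_ge0 Bk0 q20) ?(mulr_ge0 _ c0) // ler_pM.
    rewrite /kappa ler_pdivlMr ?exprn_gt0 //.
    have -> : (B * 3 ^+ size U * (2 * ((prodn U)%:R^-1 * 2 ^+ size U))) ^+ 2 * s%:R ^+ 3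
       = 4 * B ^+ 2 * (36 ^+ size U * s%:R ^+ 3 / (prodn U)%:R ^+ 2).
      have -> : 36 ^+ size U = (3 ^+ size U * 2 ^+ size U) ^+ 2 :> R.
        by rewrite -exprMn -exprM mulnC exprM -natrM; congr (_ ^+ _); rewrite -natrX.
      by field; rewrite gt_eqF.
    rewrite ger_pMr ?mulr_gt0 ?exprn_gt0 // ler_pdivrMr ?exprn_gt0 // mul1r.
    rewrite -!natrX -natrM ler_nat -leq_sqr.
    case: (rP U rU) => _ /andP[/ltnW sq _].
    have le36 : ((36 ^ size U) ^ 2 <= prodn U)%N.
      rewrite -expnM mulnC expnM; apply: prodn_ge_exp; exact: l1296' (rsub _ rU).
    rewrite expnMn -[X in (_ <= X)%N]expnM (_ : (2 * 2 = 1 + 3)%N) // expnD expn1.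
    apply: leq_mul => //; rewrite -expnM mulnC expnM; by rewrite leq_exp2r.
  apply: le_trans (_ : w U ^+ 2 * (N%:R^-1 ^+ 2 * (c ^+ 2 * sqnorm psi)) <= _).
    by rewrite ler_wpM2l ?sqr_ge0 // ler_wpM2l ?sqr_ge0 // sqnorm_orbit_sum_le.
  have -> (a b d e : R) : a * (b ^+ 2 * (d ^+ 2 * e)) = a * (b * d) ^+ 2 * e by ring.
  by rewrite ler_wpM2r ?sqnorm_ge0.
apply: le_trans (@almost_orthogonal_sum_le R G _ r w (T g) (T (- g)) kappa eps phi Ur k0 e0 _
    diag
  (off g) (off (- g))) _.
  move=> U phi1 psi1; rewrite /T [RHS]innerZ innerC innerZ innerC; congr (_ * _).
  exact: orbit_sum_adjoint.
rewrite ler_wpM2r ?sqnorm_ge0 //.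
have -> : 8 * B ^+ 2 / s%:R ^+ 3 = kappa + kappa by rewrite /kappa; ring.
rewrite lerD2l.
have le1 : (\sum_(U <- r) `|w U|) ^+ 2 <= (B * D%:R ^+ 2) ^+ 2.
  by rewrite lerXn2r ?nnegrE ?mulr_ge0 ?sumr_ge0 ?exprn_ge0 ?(ltW B0).
apply: le_trans (_ : 2 * (eps * (B * D%:R ^+ 2) ^+ 2) <= _).
  by rewrite ler_wpM2l // ler_wpM2l.
rewrite /eps /kappa ler_pdivlMr ?exprn_gt0 //.
have -> : 2 * (2 * D%:R ^+ 2 / N%:R * (B * D%:R ^+ 2) ^+ 2) * s%:R ^+ 3
   = 4 * B ^+ 2 * (D%:R ^+ 6 * s%:R ^+ 3 / N%:R).
  by field; rewrite gt_eqF.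
rewrite ger_pMr ?mulr_gt0 ?exprn_gt0 // ler_pdivrMr // mul1r.
rewrite -!natrX -natrM ler_nat; apply: leq_trans DN.
rewrite (_ : 8 = 6 + 2)%N // expnD leq_mul // -leq_sqr -[leqRHS]expnM.
apply: leq_trans (_ : (s ^ 8 <= _)%N); first by rewrite -expnM leq_pexp2l.
by rewrite (expnM s 2 4) (leq_exp2r (s ^ 2) D (isT : 0 < 4)%N).
Qed.
End Expansions.

(** * Selberg's sieve *)

Lemma min_divr a b p : (minn a (b %/ p) <= minn a b)%N.
Proof. by rewrite leq_min geq_minl (leq_trans (geq_minr _ _)) ?leq_div. Qed.

Lemma min_divl a b p : (minn (a %/ p) b <= minn a b)%N.
Proof. by rewrite minnC [minn a b]minnC min_divr. Qed.

Lemma mul_div_le p a b : (p * (a * (b %/ p)) <= a * b)%N.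
Proof. by rewrite mulnCA leq_mul2l mulnC leq_trunc_div orbT. Qed.

Section Selberg.
Variable R : realFieldType.

(** The sum of [1 / phi(d)] over the products [d <= r] of distinct primes of [l].
    Taking out the prime [p] leaves the range [r / p] to the cofactor. *)
Fixpoint selberg_mass (l : seq nat) (r : nat) : R :=
  if l is p :: l' then selberg_mass l' r + p.-1%:R^-1 * selberg_mass l' (r %/ p) else
      (0 < r)%N%:R.

(** The sum of [mu(d) c_d(n) / phi(d)] over the same [d]. Up to normalization this
    is Selberg's optimal choice of [sum over d | n of lambda_d]. *)
Fixpoint selberg_sum (l : seq nat) (r n : nat) : R :=
  if l is p :: l' then selberg_sum l' r n + ram1 R p n * selberg_sum l' (r %/ p) n else
      (0 < r)%N%:R.

Lemma selberg_mass_ge0 l r : 0 <= selberg_mass l r.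
Proof. by elim: l r => [|p l IH] r //=; rewrite addr_ge0 ?mulr_ge0 ?invr_ge0. Qed.

Lemma selberg_mass_mono l r r' : (r <= r')%N -> selberg_mass l r <= selberg_mass l r'.
Proof.
elim: l r r' => [|p l IH] r r' rr' /=; first by rewrite ler_nat; lia.
by rewrite lerD ?IH // ler_wpM2l ?invr_ge0 ?IH ?leq_div2r.
Qed.

Lemma selberg_mass_ge1 l r : (0 < r)%N -> 1 <= selberg_mass l r.
Proof.
move=> r0; elim: l => [|p l IH] /=; first by rewrite r0.
by apply: ler_wpDr => //; rewrite mulr_ge0 ?invr_ge0 ?selberg_mass_ge0.
Qed.

Lemma selberg_sum_coprime l r n : all (fun p => ~~ (p %| n)%N) l ->
    selberg_sum l r n = selberg_mass l r.
Proof.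
elim: l r => [|p l IH] r //= /andP[pn al].
by rewrite !IH // /ram1 (negbTE pn).
Qed.

(** The square of a function of [n] that depends only on whether [p] divides [n] is
    again a combination of [1] and [ram1 p]; its mean is [1 / (p - 1)]. *)
Lemma ram1_sqr p n : prime p ->
  ram1 R p n ^+ 2 = p.-1%:R^-1 + (p.-1%:R^-1 - 1) * ram1 R p n.
Proof. by move=> pp; rewrite /ram1; case: ifP => _; ring. Qed.

Lemma inv_pred_itv p : 0 <= (p.-1%:R^-1 : R) <= 1.
Proof.
rewrite invr_ge0 ler0n /=; case: p.-1 => [|k]; first by rewrite invr0.
by rewrite invf_le1 ?ltr0n // ler1n.
Qed.

(** Adding a prime [p] to the list multiplies out
    [(x + ram1 p * x') * (y + ram1 p * y')], and [ram1_sqr] reduces the square. A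
    prime of [U] has then three possible origins, whence [3 ^ size U]. The primes
    common to both factors and absent from [U] carry the weights [1 / (p - 1)] and
    sum up to at most the mass. The constant coefficient is exactly the mass, which
    is the diagonal of the product. *)
Lemma selberg_sum_mul_expansion l r1 r2 : uniq l -> all prime l ->
  exists w : seq nat -> R, w [::] = selberg_mass l (minn r1 r2) /\
    (forall n, selberg_sum l r1 n * selberg_sum l r2 n = \sum_(U <- subseqs l) w U * ram R U n)
        /\
    {in subseqs l, forall U, `|w U| <= 3 ^+ size U * selberg_mass l (minn r1 r2)
                       /\ (w U != 0 -> (prodn U <= r1 * r2)%N)}.
Proof.
elim: l r1 r2 => [|p l IH] r1 r2.
  move=> _ _; exists (fun _ => (0 < r1)%N%:R * (0 < r2)%N%:R).
  split; first by rewrite /= leq_min -natrM mulnb.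
  split=> [n|U].
    by rewrite big_seq1 /ram big_nil mulr1.
  rewrite inE => /eqP->; rewrite expr0 mul1r /= leq_min -natrM mulnb ger0_norm //.
  by split=> //; rewrite pnatr_eq0 eqb0 negbK /prodn big_nil muln_gt0.
rewrite [uniq _]/= [all _ _]/= => /andP[pl Ul] /andP[pp al].
have [w11 [Z11 [E11 H11]]] := IH r1 r2 Ul al.
have [w12 [Z12 [E12 H12]]] := IH r1 (r2 %/ p)%N Ul al.
have [w21 [Z21 [E21 H21]]] := IH (r1 %/ p)%N r2 Ul al.
have [w22 [Z22 [E22 H22]]] := IH (r1 %/ p)%N (r2 %/ p)%N Ul al.
pose b : R := p.-1%:R^-1.
have /andP[b0 b1] : 0 <= b <= 1 by exact: inv_pred_itv.
pose wo U := w11 U + b * w22 U.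
pose wi V := w12 V + w21 V + (b - 1) * w22 V.
exists (fun U => if head 0%N U == p then wi (behead U) else wo U).
(* The default [0] of [head] is not prime, so the empty list is not caught. *)
have headF U : U \in subseqs l -> (head 0%N U == p) = false.
  move=> /subseqs_subseq/mem_subseq sub; apply/eqP; case: U sub => [|q U] sub /=.
    by move=> E; rewrite -E in pp.
  by move=> E; move: pl; rewrite -E sub ?mem_head.
have p0 := prime_gt0 pp.
set m := minn r1 r2.
have m22 : minn (r1 %/ p) (r2 %/ p) = (m %/ p)%N.
  by rewrite /m; case: (leqP r1 r2) => [le12|/ltnW le12];
    [apply/minn_idPl|apply/minn_idPr]; apply: leq_div2r.
split; first by rewrite headF ?mem_subseqs_nil // /wo Z11 Z22 m22.
split=> [n|U].
  rewrite /= big_cat big_map /=.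
  rewrite eqxx.
  have -> : \sum_(i <- subseqs l) (if head 0%N i == p then wi (behead i) else wo i)
       * ram R i n = \sum_(i <- subseqs l) wo i * ram R i n.
    by rewrite big_seq [RHS]big_seq; apply: eq_bigr => U sU; rewrite headF.
  transitivity (selberg_sum l r1 n * selberg_sum l r2 n + b
      * (selberg_sum l (r1 %/ p) n * selberg_sum l (r2 %/ p) n)
     + ram1 R p n * (selberg_sum l r1 n * selberg_sum l (r2 %/ p) n + selberg_sum l (r1 %/ p) n
         * selberg_sum l r2 n
       + (b - 1) * (selberg_sum l (r1 %/ p) n * selberg_sum l (r2 %/ p) n))).
    have := ram1_sqr n pp; rewrite -/b expr2.
    move: (selberg_sum l r1 n) (selberg_sum l (r1 %/ p) n) (selberg_sum l r2 n)
        (selberg_sum l (r2 %/ p) n).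
    move: (ram1 R p n) => u x y z t E.
    have -> : (x + u * y) * (z + u * t) = x * z + u * (x * t + y * z) + (u * u) * (y * t).
      by ring.
    by rewrite E; ring.
  rewrite E11 E12 E21 E22; congr (_ + _).
    by rewrite mulr_sumr -big_split; apply: eq_bigr => U _; rewrite /wo /=; ring.
  rewrite mulr_sumr -!big_split mulr_sumr; apply: eq_bigr => U _.
  by rewrite /wi /ram big_cons -/(ram R U n) /=; ring.
rewrite /= mem_cat => /orP[sU|/mapP[V sV ->]].
  rewrite headF //; case: (H11 U sU) => B11 N11; case: (H22 U sU) => B22 N22; split.
    apply: le_trans (ler_normD _ _) _; rewrite mulrDr lerD //.
    rewrite normrM (ger0_norm b0) -/b mulrCA ler_wpM2l //.
    by apply: le_trans B22 _; rewrite m22.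
  move=> w0; have [w11_0|] := eqVneq (w11 U) 0; last exact: N11.
  have w22_0 : w22 U != 0.
    by apply: contraNneq w0 => w22_0; rewrite /wo w11_0 w22_0 mulr0 addr0.
  by apply: leq_trans (N22 w22_0) _; rewrite leq_mul ?leq_div.
rewrite /= eqxx /=; case: (H12 V sV) => B12 N12; case: (H21 V sV) => B21 N21.
case: (H22 V sV) => B22 N22.
have hm r r' : (minn r r' <= m)%N ->
    3 ^+ size V * selberg_mass l (minn r r') <= 3 ^+ size V * selberg_mass l m.
  by move=> le_m; rewrite ler_wpM2l ?exprn_ge0 ?selberg_mass_mono.
split.
  apply: (@le_trans _ _ (3 * (3 ^+ size V * selberg_mass l m))); last first.
    rewrite exprS mulrA ler_wpM2l ?mulr_ge0 ?exprn_ge0 //.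
    by rewrite lerDl mulr_ge0 ?invr_ge0 ?selberg_mass_ge0.
  have {B12}C12 := le_trans B12 (hm r1 (r2 %/ p)%N (min_divr _ _ _)).
  have {B21}C21 := le_trans B21 (hm (r1 %/ p)%N r2 (min_divl _ _ _)).
  have {B22}C22 := le_trans B22 (hm (r1 %/ p)%N (r2 %/ p)%N
    (leq_trans (min_divr _ _ _) (min_divl _ _ _))).
  have b2 : `|(b - 1) * w22 V| <= `|w22 V|.
    by rewrite normrM ler_piMl // ler_norml; apply/andP; split; lra.
  have := ler_normD (w12 V + w21 V) ((b - 1) * w22 V).
  have := ler_normD (w12 V) (w21 V); rewrite /wi; lra.
rewrite /prodn big_cons -/(prodn V) => w0.
have [w12_0|/N12 le12] := eqVneq (w12 V) 0; last first.
  by apply: leq_trans (mul_div_le p r1 r2); rewrite leq_mul2l le12 orbT.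
have [w21_0|/N21 le21] := eqVneq (w21 V) 0; last first.
  apply: (@leq_trans (p * (r1 %/ p * r2))); first by rewrite leq_mul2l le21 orbT.
  by rewrite mulnA leq_mul2r mulnC leq_trunc_div orbT.
have /N22 le22 : w22 V != 0.
  by apply: contraNneq w0 => w22_0; rewrite /wi w12_0 w21_0 w22_0 mulr0 !addr0.
apply: leq_trans (mul_div_le p r1 r2); rewrite leq_mul2l (leq_trans le22) ?orbT //.
by rewrite leq_mul2r leq_div orbT.
Qed.

Definition sifted_harmonic (l : seq nat) (r : nat) : R :=
  \sum_(1 <= m < r.+1 | all (fun p => ~~ (p %| m)%N) l) m%:R^-1.

Lemma sifted_harmonic_ge0 l r : 0 <= sifted_harmonic l r.
Proof. by apply: sumr_ge0 => m _; rewrite invr_ge0. Qed.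

Lemma sifted_harmonic_mono l r r' : (r <= r')%N -> sifted_harmonic l r <= sifted_harmonic l r'.
Proof.
move=> rr'; rewrite /sifted_harmonic [leRHS](@big_cat_nat _ _ _ r.+1) //= lerDl.
by apply: sumr_ge0 => m _; rewrite invr_ge0.
Qed.

Lemma sum_multiples (F : nat -> R) p r : (0 < p)%N ->
  \sum_(1 <= m < r.+1 | (p %| m)%N) F m = \sum_(1 <= m < (r %/ p).+1) F (p * m)%N.
Proof.
move=> p0; rewrite -big_filter -[RHS](big_map (muln p) predT F).
apply: perm_big; apply: uniq_perm.
- by rewrite filter_uniq // iota_uniq.
- rewrite map_inj_uniq ?iota_uniq // => x y /eqP.
  by rewrite eqn_pmul2l // => /eqP.
move=> m; rewrite mem_filter mem_index_iota; apply/idP/mapP.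
  case/andP=> /dvdnP[k ->] /andP[k1 k2]; exists k; last by rewrite mulnC.
  by rewrite mem_index_iota ltnS leq_divRL // -[(_ <= r)%N]ltnS k2 andbT; case: (k) k1.
case=> k; rewrite mem_index_iota ltnS leq_divRL // => /andP[k1 k2] ->.
by rewrite dvdn_mulr //= muln_gt0 p0 k1 ltnS mulnC.
Qed.

Lemma sifted_harmonic_cons l p r : prime p -> all prime l -> p \notin l ->
  sifted_harmonic l r = sifted_harmonic (p :: l) r + p%:R^-1 * sifted_harmonic l (r %/ p).
Proof.
move=> pp al pl; rewrite /sifted_harmonic (bigID (fun m => (p %| m)%N)) /= addrC.
congr (_ + _); first by apply: eq_bigl => m; rewrite andbC.
under eq_bigl do rewrite andbC.
rewrite big_mkcondr sum_multiples ?prime_gt0 // mulr_sumr [RHS]big_mkcond /=.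
apply: eq_bigr => m _; rewrite natrM invfM; congr (if _ then _ else _).
apply: eq_in_all => q ql;
    rewrite (Euclid_dvdM _ _ (allP al _ ql)) (dvdn_prime2 (allP al _ ql) pp).
rewrite (_ : (q == p) = false) //.
by apply: contraNF pl => /eqP<-.
Qed.

(** Iterating [sifted_harmonic_cons] sums the geometric series
    [1/p + 1/p^2 + ... = 1/(p - 1)]. *)
Lemma sifted_harmonic_step l p r : prime p -> all prime l -> p \notin l ->
  sifted_harmonic l r <= sifted_harmonic (p :: l) r + p.-1%:R^-1 * sifted_harmonic (p :: l)
      (r %/ p).
Proof.
move=> pp al pl; have p1 := prime_gt1 pp.
elim/ltn_ind: r => r IH; rewrite (sifted_harmonic_cons r pp al pl) lerD2l.
have [->|r0] := posnP r; first by rewrite div0n /sifted_harmonic !big_geq // !mulr0.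
apply: le_trans (_ : p%:R^-1 * ((1 + p.-1%:R^-1) * sifted_harmonic (p :: l) (r %/ p)) <= _).
  rewrite ler_wpM2l ?invr_ge0 //; apply: le_trans (IH (r %/ p)%N _) _.
    by rewrite ltn_Pdiv.
  rewrite mulrDl mul1r lerD2l ler_wpM2l ?invr_ge0 ?sifted_harmonic_mono ?leq_div //.
have -> : p%:R = 1 + p.-1%:R :> R by rewrite -{1}(ltn_predK p1) -natr1 addrC.
have q0 : 0 < p.-1%:R :> R by rewrite ltr0n; lia.
rewrite mulrA ler_wpM2r ?sifted_harmonic_ge0 // le_eqVlt; apply/orP; left; apply/eqP.
by field; rewrite !gt_eqF //; lra.
Qed.

(** When all the primes up to [r] are removed only [m = 1] remains, and every
    removal is paid for by one step of the recursion that defines the mass. *)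
Lemma sifted_harmonic_le_mass rest l r : uniq (l ++ rest) -> all prime (l ++ rest) ->
  (forall p, prime p -> (p <= r)%N -> p \in l ++ rest) ->
  sifted_harmonic l r <= selberg_mass rest r.
Proof.
elim: rest l r => [|p rest IH] l r.
  rewrite cats0 => _ al H; rewrite /=; case: r H => [|r] H.
    by rewrite /sifted_harmonic big_geq.
  rewrite /sifted_harmonic big_mkcond big_ltn // big_nat_cond big1 ?addr0.
    by rewrite /= addr0; case: ifP => _; rewrite ?invr1.
  move=> m /andP[/andP[m1 mr] _]; case: ifP => // /allP /(_ (pdiv m)).
  rewrite pdiv_dvd H ?pdiv_prime // => [/(_ isT)//|].
  by apply: leq_trans (pdiv_leq _) _ => //; exact: ltnW.
move=> U al H.
have pe : perm_eq (l ++ p :: rest) ((p :: l) ++ rest).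
  by rewrite -cat1s catA -[p :: l]cat1s perm_cat2r perm_catC.
have U' : uniq ((p :: l) ++ rest) by rewrite -(perm_uniq pe).
have al' : all prime ((p :: l) ++ rest) by rewrite -(perm_all _ pe).
have pp : prime p by case/andP: al'.
have pl : p \notin l by move: U'; rewrite /= mem_cat negb_or => /andP[/andP[]].
have all_l : all prime l by move: al; rewrite all_cat => /andP[].
apply: le_trans (sifted_harmonic_step _ pp all_l pl) _.
rewrite /= lerD ?ler_wpM2l ?invr_ge0 ?IH // => q pq qr; rewrite -(perm_mem pe) H //.
by apply: leq_trans qr _; exact: leq_div.
Qed.

Lemma sifted_harmonic_peel l1 l r : uniq (l1 ++ l) -> all prime (l1 ++ l) ->
  sifted_harmonic l r <= \prod_(p <- l1) (1 + p.-1%:R^-1) * sifted_harmonic (l1 ++ l) r.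
Proof.
elim: l1 => [|p l1 IH] /=; first by rewrite big_nil mul1r.
move=> /andP[pl U] /andP[pp al]; apply: le_trans (IH U al) _.
rewrite big_cons mulrC [(1 + _) * _]mulrC -mulrA mulrC.
rewrite ler_wpM2l //; first by apply: prodr_ge0 => q _; rewrite addr_ge0 ?invr_ge0.
apply: le_trans (sifted_harmonic_step _ pp al pl) _.
by rewrite mulrDl mul1r lerD2l ler_wpM2l ?invr_ge0 ?sifted_harmonic_mono ?leq_div.
Qed.

(** An integer [m <= r] is the product of a part built from [l1] and a part built
    from [l2]. Summing over the powers of its primes, the first part is accounted
    for by the Euler product of [l1] and the second by the mass of [l2]. *)
Lemma harmonic_le_selberg_mass l1 l2 r : uniq (l1 ++ l2) -> all prime (l1 ++ l2) ->
  (forall p, prime p -> (p <= r)%N -> p \in l1 ++ l2) ->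
  \sum_(1 <= m < r.+1) m%:R^-1 <= \prod_(p <- l1) (1 + p.-1%:R^-1) * selberg_mass l2 r.
Proof.
move=> U al H; have := @sifted_harmonic_peel l1 [::] r; rewrite cats0 => gp.
move: (U) (al); rewrite cat_uniq all_cat => /andP[U1 _] /andP[al1 _].
apply: le_trans (gp U1 al1) _; rewrite ler_wpM2l ?sifted_harmonic_le_mass //.
by apply: prodr_ge0 => q _; rewrite addr_ge0 ?invr_ge0.
Qed.

Lemma harmonic_ge k : k%:R / 2 <= \sum_(1 <= m < (2 ^ k).+1) m%:R^-1 :> R.
Proof.
elim: k => [|k IH]; first by rewrite mul0r sumr_ge0 // => m _; rewrite invr_ge0.
have k0 : (0 < 2 ^ k)%N by rewrite expn_gt0.
rewrite (@big_cat_nat _ _ _ (2 ^ k).+1) //=; last by rewrite ltnS leq_exp2l.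
rewrite -natr1 mulrDl mul1r lerD //.
apply: (@le_trans _ _ (\sum_((2 ^ k).+1 <= m < (2 ^ k.+1).+1) (2 ^ k.+1)%:R^-1)).
  rewrite sumr_const_nat subSS expnS mul2n -addnn addnK -[leRHS]mulr_natl natrD.
  have : 0 < (2 ^ k)%:R :> R by rewrite ltr0n.
  move: ((2 ^ k)%:R) => x x0; rewrite le_eqVlt; apply/orP; left; apply/eqP.
  by field; rewrite gt_eqF //; lra.
apply: ler_sum_nat => m /andP[m1 m2].
by rewrite lef_pV2 ?posrE ?ltr0n ?ler_nat //; lia.
Qed.

End Selberg.

(** * Chebyshev's bounds and Mertens' product *)

Section Chebyshev.
Local Open Scope nat_scope.

Lemma bin_central_ge m : 2 ^ m <= 'C(m + m, m).
Proof.
elim: m => [|m IH] //; rewrite addSn addnS.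
have E : 'C((m + m).+2, m.+1) = 2 * 'C((m + m).+1, m).
  have E1 := @bin_sub (m + m).+1 m; rewrite (_ : (m + m).+1 - m = m.+1) in E1; last by lia.
  by rewrite binS E1; lia.
by rewrite E expnS leq_mul2l /= (leq_trans IH) // leq_bin2l.
Qed.

Lemma bin_le_pow2 n m : 'C(n, m) <= 2 ^ n.
Proof.
elim: n m => [|n IH] [|m]; rewrite ?bin0 ?expn_gt0 // ?bin0n //.
by rewrite binS expnS mul2n -addnn leq_add.
Qed.

Lemma bin_central_factor m :
  'C(m + m, m) = \prod_(p <- primes 'C(m + m, m)) p ^ logn p 'C(m + m, m).
Proof.
have c0 : 0 < 'C(m + m, m) by rewrite bin_gt0 leq_addr.
by rewrite {1}(prod_prime_decomp c0) prime_decompE big_map.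
Qed.

(** In Legendre's formula the power [p^i] contributes
    [(2m) / p^i - 2 (m / p^i)], with integer divisions. This is [0] or [1], and [0]
    as soon as [p^i > 2m]. *)
Lemma logn_bin_central p m : prime p -> 0 < m -> p ^ logn p 'C(m + m, m) <= m + m.
Proof.
move=> pp m0; have p1 := prime_gt1 pp.
have E : logn p (m + m)`! = logn p 'C(m + m, m) + (logn p m`! + logn p m`!).
  have := bin_fact (leq_addr m m); rewrite addnK => <-.
  by rewrite !lognM ?muln_gt0 ?fact_gt0 ?bin_gt0 ?leq_addr.
have E1 : logn p m`! = \sum_(1 <= i < (m + m).+1) m %/ p ^ i.
  rewrite logn_fact // [RHS](@big_cat_nat _ _ _ m.+1) ?ltnS ?leq_addr //=.
  rewrite [X in _ = _ + X]big_nat_cond [X in _ = _ + X]big1 ?addn0 // => i /andP[/andP[im _] _].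
  by rewrite divn_small // (leq_trans im) // ltnW // ltn_expl.
have le1 : logn p 'C(m + m, m) <= \sum_(1 <= i < (m + m).+1) (i <= trunc_log p (m + m)).
  suff : logn p (m + m)`! <= \sum_(1 <= i < (m + m).+1) (i <= trunc_log p (m + m))
      + (logn p m`! + logn p m`!) by rewrite E; lia.
  rewrite logn_fact // E1 -!big_split /=; apply: leq_sum => i _.
  have pi0 : 0 < p ^ i by rewrite expn_gt0 ltnW.
  case: (leqP i (trunc_log p (m + m))) => [_|lt_i].
    have E2 := divn_eq m (p ^ i); have lt2 := ltn_pmod m pi0.
    have : (m + m) %/ p ^ i < (1 + (m %/ p ^ i + m %/ p ^ i)).+1.
      by rewrite ltn_divLR //; nia.
    by [].
  rewrite divn_small //; apply: leq_trans (trunc_log_ltn _ p1) _.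
  by rewrite leq_exp2l.
apply: leq_trans (_ : p ^ trunc_log p (m + m) <= _); last first.
  by rewrite trunc_logP // addn_gt0 m0.
rewrite leq_exp2l //; apply: leq_trans le1 _.
have H t n : \sum_(1 <= i < n.+1) (i <= t) <= t.
  elim: n t => [|n IH] t; first by rewrite big_geq.
  rewrite big_nat_recr //=; case: (leqP n.+1 t) => [nt|_]; last by rewrite addn0.
  have : \sum_(1 <= i < n.+1) (i <= t) <= \sum_(1 <= i < n.+1) 1.
    by apply: leq_sum => i _; case: (i <= t).
  rewrite sum_nat_const_nat muln1 subSS subn0; lia.
exact: H.
Qed.

Lemma prime_dvd_fact p n : prime p -> (p %| n`!) = (p <= n).
Proof.
move=> pp; apply/idP/idP => [|pn]; last by rewrite dvdn_fact ?prime_gt0.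
elim: n => [|n IH]; first by rewrite dvdn1 => /eqP pE; rewrite pE in pp.
by rewrite factS Euclid_dvdM // => /orP[/dvdn_leq->//|/IH/leqW].
Qed.

Lemma dvdn_bin_central p m : prime p -> m < p -> (p %| 'C(m + m, m)) = (p <= m + m).
Proof.
move=> pp mp; have := bin_fact (leq_addr m m); rewrite addnK => /(congr1 (dvdn p)).
by rewrite !Euclid_dvdM // !prime_dvd_fact // [p <= m]leqNgt mp /= orbF.
Qed.

Lemma primes_bin_central m p : p \in primes 'C(m + m, m) -> prime p /\ 0 < p <= m + m.
Proof.
rewrite mem_primes => /and3P[pp _ pC]; split=> //; rewrite prime_gt0 //=.
have [|mp] := leqP p m; first by move=> pm; apply: leq_trans pm (leq_addr _ _).
by rewrite -dvdn_bin_central.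
Qed.

(** The central binomial coefficient of [2^k] is at least [2^(2^(k-1))], and each
    of its prime powers is at most [2^k]. *)
Lemma chebyshev_lower k : 0 < k -> 2 ^ k.-1 <= k * count prime (iota 1 (2 ^ k)).
Proof.
case: k => // k _ /=; set m := 2 ^ k.
have m0 : 0 < m by rewrite expn_gt0.
have mm : m + m = 2 ^ k.+1 by rewrite expnS mul2n addnn.
rewrite -(@leq_exp2l 2) //; apply: leq_trans (bin_central_ge m) _.
rewrite bin_central_factor.
apply: leq_trans (_ : \prod_(p <- primes 'C(m + m, m)) (m + m) <= _).
  rewrite big_seq [leqRHS]big_seq; apply: leq_prod => p /primes_bin_central[pp _].
  exact: logn_bin_central.
rewrite big_const_seq count_predT iter_muln_1 [X in X ^ _ <= _]mm -expnM leq_exp2l // leq_mul2l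
    /=.
rewrite -size_filter; apply: uniq_leq_size; first exact: primes_uniq.
by move=> p /primes_bin_central[pp]; rewrite mem_filter pp mem_iota add1n ltnS mm.
Qed.

(** Every prime between [2^k] and [2^(k+1)] divides the central binomial
    coefficient of [2^(k+1)], which is at most [2^(2^(k+1))]. *)
Lemma chebyshev_upper k :
  k * count prime (iota (2 ^ k).+1 (2 ^ k)) <= 2 * 2 ^ k.
Proof.
set m := 2 ^ k.
have mm : m + m = 2 ^ k.+1 by rewrite expnS mul2n addnn.
rewrite -(@leq_exp2l 2) // expnM -/m mul2n -addnn.
apply: leq_trans (bin_le_pow2 (m + m) m); rewrite bin_central_factor.
rewrite (bigID (fun p => m < p)) /=.
apply: leq_trans (leq_pmulr _ _); last first.
  by rewrite big_seq_cond prodn_cond_gt0 // => p /andP[/primes_bin_central[_ /andP[p0 _]] _];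
     rewrite expn_gt0 p0.
apply: leq_trans (_ : \prod_(p <- primes 'C(m + m, m) | m < p) m <= _); last first.
  rewrite big_seq_cond [leqRHS]big_seq_cond; apply: leq_prod => p /andP[pC mp].
  have [pp _] := primes_bin_central pC.
  apply: leq_trans (ltnW mp) _; rewrite -{1}(expn1 p) leq_pexp2l ?(prime_gt0 pp) //.
  by rewrite logn_gt0.
rewrite big_const_seq iter_muln_1 leq_pexp2l ?expn_gt0 //.
rewrite -!size_filter; apply: uniq_leq_size; first by rewrite filter_uniq ?iota_uniq.
move=> p; rewrite !mem_filter mem_iota => /and3P[pp mp pm]; rewrite mp /=.
rewrite mem_primes pp bin_gt0 leq_addr /= dvdn_bin_central //; lia.
Qed.

End Chebyshev.

Section MertensProduct.
Local Open Scope ring_scope.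
Variable R : realFieldType.

Lemma exp1D_mul_le1 (x : R) n : 0 <= x -> n%:R * x <= 1 -> (1 + x) ^+ n * (1 - n%:R * x) <= 1.
Proof.
move=> x0; elim: n => [|n IH] nx; first by rewrite mul0r subr0 expr0 mulr1.
have nx' : n%:R * x <= 1.
  by apply: le_trans nx; rewrite ler_wpM2r // ler_nat.
apply: le_trans (IH nx'); rewrite exprSr -mulrA ler_wpM2l ?exprn_ge0 ?addr_ge0 //.
rewrite -natr1; have n0 : 0 <= n%:R :> R by []; nra.
Qed.

(** There are at most [2 * 2^k / k] factors, each at most [1 + 2^(-k)], so the
    product is at most [1 / (1 - 2/k)]. *)
Lemma block_product_le k : (2 < k)%N ->
  \prod_(p <- iota (2 ^ k).+1 (2 ^ k) | prime p) (1 + p.-1%:R^-1) <= k%:R / (k%:R - 2) :> R.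
Proof.
move=> k2; set m := (2 ^ k)%N; set c := count prime (iota m.+1 m).
have m0 : (0 < m)%N by rewrite expn_gt0.
have m0' : 0 < m%:R :> R by rewrite ltr0n.
have k2' : 2 < k%:R :> R by rewrite ltr_nat.
have kc : k%:R * (c%:R / m%:R) <= 2 :> R.
  by rewrite mulrA ler_pdivrMr // -!natrM ler_nat chebyshev_upper.
have le1 : \prod_(p <- iota m.+1 m | prime p) (1 + p.-1%:R^-1) <= (1 + m%:R^-1) ^+ c :> R.
  rewrite /c -size_filter -big_filter.
  have : all (fun p => m < p)%N [seq p <- iota m.+1 m | prime p].
    by apply/allP => p; rewrite mem_filter mem_iota => /and3P[].
  elim: (filter _ _) => [|p l IH] /=; first by rewrite big_nil.
  move=> /andP[mp /IH le]; rewrite big_cons exprS; apply: ler_pM.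
  - by rewrite addr_ge0 ?invr_ge0.
  - by apply: prodr_ge0 => q _; rewrite addr_ge0 ?invr_ge0.
  - by rewrite lerD2l lef_pV2 ?posrE ?ltr0n ?ler_nat //; lia.
  - exact: le.
apply: le_trans le1 _; rewrite ler_pdivlMr; last by lra.
set x := m%:R^-1 : R; have x0 : 0 <= x by rewrite invr_ge0.
have cx : k%:R * (c%:R * x) <= 2 by exact: kc.
have cx1 : c%:R * x <= 1 by have : 0 <= c%:R * x; [exact: mulr_ge0|nra].
have := exp1D_mul_le1 x0 cx1.
have : 0 <= (1 + x) ^+ c by rewrite exprn_ge0 ?addr_ge0.
move: (_ ^+ c) (c%:R * x) cx => y z; nra.
Qed.

(** The bounds [k / (k - 2)] of the dyadic blocks telescope. The exponent [2] of [b]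
    is the constant [2] of [chebyshev_upper]. *)
Lemma mertens_product_le b : (2 < b)%N ->
  \prod_(p <- iota 1 (2 ^ b) | prime p) (1 + p.-1%:R^-1) <= 3 * b%:R ^+ 2 :> R.
Proof.
move=> b2.
suff : \prod_(p <- iota 1 (2 ^ b) | prime p) (1 + p.-1%:R^-1)
   <= 3 * ((b%:R - 1) * (b%:R - 2)) :> R.
  move=> le1; apply: le_trans le1 _.
  have b2' : 2 < b%:R :> R by rewrite ltr_nat.
  nra.
elim: b b2 => // b IH; rewrite ltnS leq_eqVlt => /orP[/eqP<-|b2].
  by rewrite /= !big_cons big_nil /=; lra.
have b2' : 2 < b%:R :> R by rewrite ltr_nat.
have -> : (2 ^ b.+1 = 2 ^ b + 2 ^ b)%N by rewrite expnS mul2n addnn.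
rewrite iotaD big_cat /= add1n.
apply: le_trans (ler_pM _ _ (IH b2) (block_product_le b2)) _.
- by apply: prodr_ge0 => q _; rewrite addr_ge0 ?invr_ge0.
- by apply: prodr_ge0 => q _; rewrite addr_ge0 ?invr_ge0.
rewrite -natr1 le_eqVlt; apply/orP; left; apply/eqP; field.
by rewrite gt_eqF // subr_gt0.
Qed.

End MertensProduct.

(** * Exact sieves by small primes *)

Section RoughWeights.
Variable R : realFieldType.
Implicit Types (l : seq nat) (f : nat -> R).

(** The indicator of the integers prime to all of [l], divided by its density. *)
Definition rough_weight l n : R := \prod_(p <- l) (1 + ram1 R p n).

Lemma rough_weight_cat l1 l2 n : rough_weight (l1 ++ l2) n
    = rough_weight l1 n * rough_weight l2 n.
Proof. exact: big_cat. Qed.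

Lemma rough_weight_ge0 l n : 0 <= rough_weight l n.
Proof.
apply: prodr_ge0 => p _; have := ram1_le1 R p n; rewrite ler_norml => /andP[lo _].
by lra.
Qed.

Lemma rough_weight_periodic l n : rough_weight l (n + prodn l) = rough_weight l n.
Proof.
rewrite /rough_weight big_seq [RHS]big_seq; apply: eq_bigr => p pl.
by rewrite ram1_periodic // /prodn (big_rem p) //= dvdn_mulr.
Qed.

Lemma rough_weight_coprime l n : all (fun p => ~~ (p %| n)%N) l ->
  rough_weight l n = \prod_(p <- l) (1 + p.-1%:R^-1).
Proof.
move=> /allP al; rewrite /rough_weight big_seq [RHS]big_seq; apply: eq_bigr => p pl.
by rewrite /ram1 (negbTE (al _ pl)).
Qed.

Lemma rough_weight_expand l n : rough_weight l n = \sum_(U <- subseqs l) ram R U n.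
Proof.
elim: l => [|p l IH]; first by rewrite big_seq1 /rough_weight /ram !big_nil.
rewrite /rough_weight big_cons -/(rough_weight l n) IH /= big_cat big_map /= mulrDl mul1r;
    congr (_ + _).
by rewrite mulr_sumr; apply: eq_bigr => U _; rewrite /ram big_cons.
Qed.

Lemma eq_ram_expansion l B y D f1 f2 : f1 =1 f2 -> ram_expansion l B y D f1 ->
    ram_expansion l B y D f2.
Proof. by move=> E [w [fE H]]; exists w; split=> // n; rewrite -E. Qed.

Lemma ram_expansion_weaken l B y D D' f : (D <= D')%N -> ram_expansion l B y D f ->
    ram_expansion l B y D' f.
Proof.
move=> DD [w [fE H]]; exists w; split=> // U /H[b N]; split=> // /N /andP[-> /=].
by move/leq_trans; apply.
Qed.

Lemma ram_expansion_scale l B y D f c : ram_expansion l B y D f ->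
  ram_expansion l (`|c| * B) y D (fun n => c * f n).
Proof.
move=> [w [fE H]]; exists (fun U => c * w U); split=> [n|U /H[b N]].
  by rewrite fE mulr_sumr; apply: eq_bigr => U _; rewrite mulrA.
split; first by rewrite normrM -mulrA ler_wpM2l.
by rewrite mulf_eq0 negb_or => /andP[_ /N].
Qed.

(** A modulus other than [1] is a multiple of a prime of [l], hence exceeds [y]. *)
Lemma ram_expansion_nonconst l B y D f (w : seq nat -> R) : all (leq y.+1) l -> all prime l ->
  uniq l -> 0 <= B ->
  (forall n, f n = \sum_(U <- subseqs l) w U * ram R U n) ->
  {in subseqs l, forall U, `|w U| <= B * 3 ^+ size U /\ (w U != 0 -> (prodn U <= D)%N)} ->
  ram_expansion l B y D (fun n => f n - w [::]).
Proof.
move=> ly al Ul B0 fE H; exists (fun U => if U == [::] then 0 else w U); split=> [n|U sU].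
  rewrite fE !(bigD1_seq _ (mem_subseqs_nil l) (subseqs_uniq Ul)) /= mul0r add0r.
  rewrite {1}/ram big_nil mulr1 addrAC subrr add0r.
  by apply: eq_bigr => U /negbTE->.
have [b N] := H U sU; case: eqP => [->|/eqP Un0].
  by rewrite normr0 eqxx mulr1; split.
split=> // /N->; rewrite andbT.
have {sU}sU : all (leq y.+1) U /\ all prime U.
  by move: sU => /subseqs_subseq /mem_subseq sub; split; apply/allP => p /sub; apply: allP.
case: U Un0 sU {b N} => // p U _ [/= /andP[yp _] /andP[pp aU]].
by rewrite /prodn big_cons -/(prodn U) (leq_trans yp) // leq_pmulr // prodn_gt0.
Qed.

Lemma ram_expansion_cons p l B y D f : prime p -> p \notin l -> 0 <= B ->
  ram_expansion l B y D f ->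
      ram_expansion (p :: l) B y (p * D) (fun n => (1 + ram1 R p n) * f n).
Proof.
move=> pp pl B0 [w [fE H]].
have p0 := prime_gt0 pp.
exists (fun U => if head 0%N U == p then w (behead U) else w U).
have headF U : U \in subseqs l -> (head 0%N U == p) = false.
  move=> /subseqs_subseq/mem_subseq sub; apply/eqP; case: U sub => [|q U] sub /=.
    by move=> E; rewrite -E in pp.
  by move=> E; move: pl; rewrite -E sub ?mem_head.
split=> [n|U].
  rewrite /= big_cat big_map /= eqxx mulrDl mul1r fE; congr (_ + _).
    by rewrite big_seq [RHS]big_seq; apply: eq_bigr => U sU; rewrite headF.
  by rewrite mulr_sumr; apply: eq_bigr => U _; rewrite /ram big_cons mulrCA.
rewrite /= mem_cat => /orP[sU|/mapP[V sV ->]].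
  rewrite headF //; have [b N] := H U sU; split=> // /N/andP[-> /= /leq_trans]; apply.
  exact: leq_pmull.
rewrite /= eqxx; have [b N] := H V sV; split=> [|/N/andP[lo hi]].
  apply: le_trans b _; rewrite ler_wpM2l // exprS ler_peMl ?exprn_ge0 //; lra.
rewrite /prodn big_cons -/(prodn V) leq_mul2l hi orbT andbT.
by apply: leq_trans lo _; exact: leq_pmull.
Qed.

Lemma ram_expansion_rough_weight l1 l2 B y D f : uniq (l1 ++ l2) -> all prime (l1 ++ l2) ->
    0 <= B ->
  ram_expansion l2 B y D f ->
  ram_expansion (l1 ++ l2) B y (prodn l1 * D) (fun n => rough_weight l1 n * f n).
Proof.
move=> U al B0 H; elim: l1 U al => [|p l1 IH] /=.
  move=> _ _; rewrite /prodn big_nil mul1n; apply: eq_ram_expansion H => n.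
  by rewrite /rough_weight big_nil mul1r.
move=> /andP[pl U] /andP[pp al]; rewrite /prodn big_cons -/(prodn l1) -mulnA.
apply: eq_ram_expansion (ram_expansion_cons pp pl B0 (IH U al)) => n.
by rewrite /rough_weight big_cons mulrA.
Qed.

Lemma ram_expansion_rough_weight_sub1 l y : uniq l -> all prime l -> all (leq y.+1) l ->
  ram_expansion l 1 y (prodn l) (fun n => rough_weight l n - 1).
Proof.
move=> U al ly.
apply: (@ram_expansion_nonconst l 1 y (prodn l) (rough_weight l) (fun _ => 1)) => //.
  by move=> n; rewrite rough_weight_expand; apply: eq_bigr => V _; rewrite mul1r.
move=> V sV; rewrite normr1 mul1r; split; first by rewrite exprn_ege1 // ler1n.
move=> _; apply: dvdn_leq; first exact: prodn_gt0.
elim: l V sV {U al ly} => [|p l IH] V /=; first by rewrite inE => /eqP->.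
rewrite mem_cat => /orP[/IH|/mapP[W /IH dW ->]]; rewrite /prodn !big_cons.
  exact: dvdn_mull.
by apply: dvdn_mul.
Qed.

Lemma ram_expansion_selberg_sum_sqr l y r : uniq l -> all prime l -> all (leq y.+1) l ->
  ram_expansion l (selberg_mass R l r) y (r * r)
      (fun n => selberg_sum R l r n ^+ 2 - selberg_mass R l r).
Proof.
move=> U al ly; have [w [w0 [wE H]]] := @selberg_sum_mul_expansion R l r r U al.
rewrite minnn in w0; rewrite -{2}w0.
apply: ram_expansion_nonconst => //; first exact: selberg_mass_ge0.
by move=> V /H[b N]; split=> //; rewrite mulrC -[r in selberg_mass R l r]minnn.
Qed.

End RoughWeights.

(** * From norms to cardinalities *)

Section Counting.
Variables (R : realFieldType) (G : finZmodType).
Implicit Types (phi : G -> R) (f : nat -> R).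

Lemma chebyshev_count (h : G -> R) u : 0 < u ->
  u ^+ 2 * #|[set x | u < `|h x|]|%:R <= sqnorm h.
Proof.
move=> u0; rewrite mulr_natr -sumr_const /sqnorm [leRHS](bigID (mem [set x | u < `|h x|])) /=.
apply: ler_wpDr; first by apply: sumr_ge0 => x _; exact: sqr_ge0.
apply: ler_sum => x; rewrite inE => ux.
by rewrite -(real_normK (num_real (h x))) lerXn2r ?nnegrE ?(ltW u0) // ltW.
Qed.

Lemma sqr_sum_le (I : Type) (r : seq I) (F : I -> R) :
  (\sum_(i <- r) F i) ^+ 2 <= (size r)%:R * \sum_(i <- r) F i ^+ 2.
Proof.
elim: r => [|i r IH]; first by rewrite !big_nil expr0n mulr0.
rewrite !big_cons /= -natr1; move: IH.
set S := \sum_(_ <- _) F _; set T := \sum_(_ <- _) _ ^+ 2.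
have -> : (F i + S) ^+ 2 = F i ^+ 2 + S ^+ 2 + 2 * (F i * S) by ring.
have [r0|r0] := posnP (size r).
  by rewrite /S /T (size0nil r0) !big_nil /= => _; lra.
have n0 : 0 < (size r)%:R :> R by rewrite ltr0n.
move: (_%:R) n0 => n n0 IH.
have := sqr_ge0 (n * F i - S).
have -> : (n * F i - S) ^+ 2 = n * (n * F i ^+ 2 - 2 * (F i * S)) + S ^+ 2 by ring.
move=> H; rewrite -(ler_pM2l n0).
have : n * S ^+ 2 <= n * (n * T) by rewrite ler_pM2l.
lra.
Qed.

Lemma maximal_count phi g t K : (forall x, 0 <= phi x) -> 0 < t ->
  #|[set x | [exists m : 'I_K, t * m.+1%:R < \sum_(0 <= i < m.+1) phi (x + g *+ i)]]|%:R
   <= t^-1 * \sum_x phi x.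
Proof.
by move=> phi0 t0; rewrite ler_pdivlMl // maximal_ergodic // ltW.
Qed.

(** The average over [m] periods is the average, over [m] translations by [P], of
    the function [h] obtained by averaging over one period. By Cauchy-Schwarz its
    square is at most the average of [h ^ 2], to which the maximal inequality for
    the translation by [P g] applies. *)
Lemma periodic_maximal_count phi f g (P K : nat) (A u : R) : (0 < P)%N -> 0 < u ->
  (forall n, f (n + P)%N = f n) ->
  sqnorm (fun x => P%:R^-1 * orbit_sum f P g phi x) <= A ->
  #|[set x | [exists m : 'I_K, u * (m.+1 * P)%:R < `|orbit_sum f (m.+1 * P) g phi x|]]|%:R
   <= u ^- 2 * A.
Proof.
move=> P0 u0 per leA; set h := fun x => P%:R^-1 * orbit_sum f P g phi x.
have P0' : 0 < P%:R :> R by rewrite ltr0n.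
apply: le_trans (_ : u ^- 2 * sqnorm h <= _); last first.
  by rewrite ler_wpM2l // invr_ge0 exprn_ge0 // ltW.
have h0 x : 0 <= h x ^+ 2 by exact: sqr_ge0.
apply: le_trans (@maximal_count (fun x => h x ^+ 2) (g *+ P) (u ^+ 2) K h0 _); last first.
  by rewrite exprn_gt0.
rewrite ler_nat; apply: subset_leq_card; apply/subsetP => x; rewrite !inE.
move=> /existsP[m lt_m]; apply/existsP; exists m.
have E : orbit_sum f (m.+1 * P) g phi x = P%:R * \sum_(0 <= k < m.+1) h (x + g *+ P *+ k).
  rewrite /orbit_sum sum_blocks mulr_sumr; apply: eq_bigr => k _.
  rewrite /h mulrA mulfV ?gt_eqF // mul1r /orbit_sum; apply: eq_bigr => i _.
  by rewrite (periodic_mul per) -mulrnA -addrA -mulrnDr mulnC addnC.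
move: lt_m; rewrite E normrM (ger0_norm (ltW P0')) natrM.
have -> : u * (m.+1%:R * P%:R) = P%:R * (u * m.+1%:R) by ring.
rewrite ltr_pM2l // => lt_m.
have m0 : 0 < m.+1%:R :> R by rewrite ltr0n.
rewrite -(ltr_pM2l m0).
have := sqr_sum_le (index_iota 0 m.+1) (fun k => h (x + g *+ P *+ k)).
rewrite size_iota subn0; apply: lt_le_trans.
rewrite -(real_normK (num_real (\sum_(_ <= _ < _) _))).
have -> : m.+1%:R * (u ^+ 2 * m.+1%:R) = (u * m.+1%:R) ^+ 2 :> R by ring.
by rewrite ltrXn2r ?nnegrE ?mulr_ge0 // ltW.
Qed.

Lemma card_has (I : Type) (r : seq I) (A : I -> {set G}) :
  (#|[set x | has (fun i => x \in A i) r]| <= \sum_(i <- r) #|A i|)%N.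
Proof.
elim: r => [|i r IH]; first by rewrite big_nil leqn0 cards_eq0; apply/eqP/setP => x;
    rewrite !inE.
rewrite big_cons; apply: leq_trans (leq_add (leqnn _) IH).
apply: leq_trans (leq_card_setU _ _); apply: subset_leq_card; apply/subsetP => x.
by rewrite !inE.
Qed.

End Counting.

(** * Levels and scales *)

Definition primes_in (x y : nat) : seq nat := [seq p <- iota x.+1 (y - x) | prime p].

Lemma mem_primes_in x y p : (p \in primes_in x y) = prime p && (x < p <= y)%N.
Proof. by rewrite mem_filter mem_iota; case: (prime p) => //=; lia. Qed.

Lemma primes_in_uniq x y : uniq (primes_in x y).
Proof. by rewrite filter_uniq // iota_uniq. Qed.

Lemma primes_in_prime x y : all prime (primes_in x y).
Proof. exact: filter_all. Qed.

Lemma primes_in_gt x y z : (z <= x.+1)%N -> all (leq z) (primes_in x y).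
Proof. by move=> zx; apply/allP => p; rewrite mem_primes_in => /and3P[_ xp _]; lia. Qed.

Lemma primes_in_cat x y z : (x <= y <= z)%N ->
  primes_in x y ++ primes_in y z = primes_in x z.
Proof.
move=> /andP[xy yz]; rewrite /primes_in -filter_cat; congr filter.
have -> : (z - x = (y - x) + (z - y))%N by lia.
by rewrite iotaD; congr (_ ++ iota _ _); lia.
Qed.

Lemma primes_in_nil x : primes_in x x = [::].
Proof. by rewrite /primes_in subnn. Qed.

Lemma prodn_cat l1 l2 : prodn (l1 ++ l2) = (prodn l1 * prodn l2)%N.
Proof. exact: big_cat. Qed.

Lemma prodn_primes_in_le x y : (0 < y)%N -> (prodn (primes_in x y) <= y ^ y)%N.
Proof.
move=> y0; apply: (@leq_trans (\prod_(p <- primes_in x y) y)).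
  rewrite /prodn big_seq [leqRHS]big_seq; apply: leq_prod => p.
  by rewrite mem_primes_in => /and3P[].
rewrite big_const_seq iter_muln_1 count_predT leq_pexp2l //.
apply: leq_trans (_ : size (iota x.+1 (y - x)) <= y)%N.
  by rewrite size_filter count_size.
by rewrite size_iota leq_subr.
Qed.

Section Scales.
Variable a : nat.

(** The base level is a large fixed power of [2^a]; it must beat the losses
    [(a^2 2^a)^2] of Chebyshev's inequality. The ratio [16] of consecutive levels
    lets the norms of [rough_step i] decrease faster than the thresholds [2^(-i)]
    allotted to them. *)
Definition level j := (2 ^ (20 * a + 4 * j))%N.
Definition level_root j := (2 ^ (10 * a + 2 * j))%N.
Definition level_primes j := primes_in (level 0) (level j).
(** A common multiple of the periods of all the steps below [j]. The eighth power
    makes one period long enough for the error terms of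
    [sqnorm_ram_expansion_le]. *)
Definition level_period j := ((prodn (level_primes j) * level j) ^ 8)%N.
(** Level [j] is used from the scale [2 ^ level_start j] on. There [2^n] exceeds
    the sixteenth power of the product of the sieving primes, which is at
    most [level j ^ level j]. At level [0] that product is empty. *)
Definition level_start j := if j is 0 then (32 * (20 * a))%N
  else (32 * (20 * a + 4 * j) * level j)%N.

Lemma level_gt0 j : (0 < level j)%N. Proof. by rewrite expn_gt0. Qed.
Lemma level_root_gt0 j : (0 < level_root j)%N. Proof. by rewrite expn_gt0. Qed.
Lemma level_root_sqr j : (level_root j ^ 2 = level j)%N.
Proof. by rewrite -expnM; congr expn; lia. Qed.
Lemma level_mono i j : (i <= j)%N -> (level i <= level j)%N.
Proof. by move=> ij; rewrite leq_exp2l //; lia. Qed.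
Lemma prodn_level_primes_gt0 j : (0 < prodn (level_primes j))%N.
Proof. by rewrite prodn_gt0 // primes_in_prime. Qed.
Lemma level_period_gt0 j : (0 < level_period j)%N.
Proof. by rewrite expn_gt0 muln_gt0 prodn_level_primes_gt0 level_gt0. Qed.
Lemma level_ge1296 j : (0 < a)%N -> (1296 <= (level j).+1)%N.
Proof.
move=> a_gt0.
apply: leqW; apply: (@leq_trans (2 ^ 20)%N); last by rewrite leq_exp2l //; lia.
by apply: (@leq_trans (2 ^ 11)%N); rewrite ?leq_exp2l.
Qed.

Lemma level_primes0 : level_primes 0 = [::]. Proof. exact: primes_in_nil. Qed.

Lemma level_primes_cat i j : (i <= j)%N -> level_primes i ++ primes_in (level i) (level j)
    = level_primes j.
Proof. by move=> ij; rewrite primes_in_cat // !level_mono. Qed.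

Lemma level_primes_dvd i j : (i <= j)%N -> (prodn (level_primes i) %| prodn (level_primes j))%N.
Proof. by move=> ij; rewrite -(level_primes_cat ij) prodn_cat dvdn_mulr. Qed.

Lemma dvdn_exp8 m n : (m %| n)%N -> (m ^ 8 %| n ^ 8)%N.
Proof. by move/dvdnP=> [k ->]; rewrite expnMn dvdn_mull. Qed.

Lemma level_period_dvd i j : (i <= j)%N -> (level_period i %| level_period j)%N.
Proof.
move=> ij; rewrite dvdn_exp8 // dvdn_mul ?level_primes_dvd // dvdn_exp2l //; lia.
Qed.

Lemma level_primes_dvd_period i j : (i <= j)%N -> (prodn (level_primes i) %| level_period j)%N.
Proof.
move=> ij; apply: dvdn_trans (level_primes_dvd ij) _.
by rewrite /level_period expnS -mulnA dvdn_mulr.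
Qed.

Lemma level_exists n : (level_start 0 <= n)%N ->
    exists j, (level_start j <= n < level_start j.+1)%N.
Proof.
move=> n0.
have ex : exists j, (n < level_start j.+1)%N.
  exists n; rewrite /level_start -mulnA; have := level_gt0 n.+1; nia.
case: (ex_minnP ex) => j nj_j minj; exists j; rewrite nj_j andbT.
by case: j nj_j minj => // j _ minj; rewrite leqNgt; apply/negP => /minj; rewrite ltnn.
Qed.

Lemma level_start_ge_index j : (j <= level_start j)%N.
Proof. by case: j => // j; rewrite /level_start; have := level_gt0 j.+1; nia. Qed.

Lemma level_start_facts j n : (level_start j <= n)%N ->
  (32 * (20 * a + 4 * j) <= n)%N /\ (prodn (level_primes j) ^ 16 <= 2 ^ n)%N.
Proof.
case: j => [|j] jn.
  split; first by move: jn; rewrite /level_start; lia.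
  by rewrite level_primes0 /prodn big_nil exp1n expn_gt0.
have Q1 := level_gt0 j.+1; split; first by move: jn; rewrite /level_start; nia.
apply: leq_trans (_ : (level j.+1 ^ level j.+1) ^ 16 <= _)%N.
  by rewrite leq_exp2r // prodn_primes_in_le.
rewrite /level -!expnM leq_exp2l // -/(level j.+1).
by apply: leq_trans jn; rewrite /level_start; nia.
Qed.

Variable R : realFieldType.

(** The part of the exact sieve due to the primes between two consecutive levels.
    All its moduli have such a prime as a factor. *)
Definition rough_step i (n : nat) : R :=
  rough_weight R (level_primes i.+1) n - rough_weight R (level_primes i) n.

Lemma rough_weight_telescope j n :
  rough_weight R (level_primes j) n = 1 + \sum_(0 <= i < j) rough_step i n.
Proof.
elim: j => [|j IH]; first by rewrite level_primes0 big_nil /rough_weight big_nil addr0.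
by rewrite big_nat_recr //= addrA -IH /rough_step addrC subrK.
Qed.

Lemma rough_step_periodic i n : rough_step i (n + level_period i.+1) = rough_step i n.
Proof.
rewrite /rough_step; have /dvdnP[k1 ->] := level_primes_dvd_period (leqnn i.+1).
rewrite (periodic_mul (rough_weight_periodic R _)); congr (_ - _).
have /dvdnP[k2 ->] := level_primes_dvd (leqnSn i).
by rewrite mulnA (periodic_mul (rough_weight_periodic R _)).
Qed.

Lemma rough_step_expansion i : ram_expansion (level_primes i.+1) 1 (level_root i ^ 2)
    (prodn (level_primes i.+1) * level i.+1) (rough_step i).
Proof.
rewrite level_root_sqr; set l' := primes_in (level i) (level i.+1).
have E := level_primes_cat (leqnSn i).
have H := @ram_expansion_rough_weight_sub1 R l' (level i) (primes_in_uniq _ _)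
    (primes_in_prime _ _)
  (primes_in_gt _ (leqnn _)).
have U : uniq (level_primes i ++ l') by rewrite E primes_in_uniq.
have al : all prime (level_primes i ++ l') by rewrite E primes_in_prime.
have := ram_expansion_rough_weight U al ler01 H; rewrite E -prodn_cat E => {}H.
apply: eq_ram_expansion (ram_expansion_weaken (leq_pmulr _ (level_gt0 i.+1)) H) => n.
by rewrite mulrBr mulr1 -rough_weight_cat E.
Qed.

Section Norms.
Variable G : finZmodType.
Implicit Types (phi : G -> R) (g : G).

Lemma sqnorm_rough_step_le i g phi : (0 < a)%N ->
  sqnorm (fun x => (level_period i.+1)%:R^-1 * orbit_sum (rough_step i) (level_period i.+1) g
      phi x)
    <= 8 / (level_root i)%:R ^+ 3 * sqnorm phi.
Proof.
have := @sqnorm_ram_expansion_le R G (level_primes i.+1) 1 (level_root i)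
    (prodn (level_primes i.+1) * level i.+1) (level_period i.+1)
  (rough_step i) g phi.
move=> H a_gt0; move: H; rewrite expr1n mulr1; apply=> //.
- exact: primes_in_uniq.
- exact: primes_in_prime.
- by apply: primes_in_gt; exact: level_ge1296 a_gt0.
- exact: level_root_gt0.
- by rewrite level_root_sqr (leq_trans (level_mono (leqnSn i))) // leq_pmull
    ?prodn_level_primes_gt0.
- exact: rough_step_expansion.
Qed.

(** The exponent [n / 32] keeps the sixteenth power of the range of Selberg's sum
    below [2^(n/2)]. *)
Definition sieve_range n := (2 ^ (n %/ 32))%N.
Definition sieve_primes j n := primes_in (level j) (sieve_range n).
(** With [h] the mass of the sieve, [L S^2 = h L + h selberg_rest], where [L] is the
    rough weight. The expansion of [selberg_rest] has coefficients bounded by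
    [3 ^ size U] independently of [h]. *)
Definition selberg_rest j n (m : nat) : R :=
  rough_weight R (level_primes j) m
    * ((selberg_mass R (sieve_primes j n) (sieve_range n))^-1
       * (selberg_sum R (sieve_primes j n) (sieve_range n) m ^+ 2
          - selberg_mass R (sieve_primes j n) (sieve_range n))).

Lemma sieve_mass_gt0 j n : 0 < selberg_mass R (sieve_primes j n) (sieve_range n).
Proof. by apply: lt_le_trans ltr01 _; apply: selberg_mass_ge1; rewrite expn_gt0. Qed.

Lemma level_le_sieve_range j n : (level_start j <= n)%N -> (level j <= sieve_range n)%N.
Proof.
move=> /level_start_facts[jn _]; rewrite leq_exp2l //.
by rewrite leq_divRL // mulnC.
Qed.

Lemma selberg_rest_expansion j n : (level_start j <= n)%N ->
  ram_expansion (level_primes j ++ sieve_primes j n) 1 (level_root j ^ 2)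
      (prodn (level_primes j) * (sieve_range n * sieve_range n)) (selberg_rest j n).
Proof.
move=> jn; have Qr := level_le_sieve_range jn; rewrite level_root_sqr.
have E : level_primes j ++ sieve_primes j n = primes_in (level 0) (sieve_range n)
    by rewrite primes_in_cat // level_mono.
apply: ram_expansion_rough_weight => //; rewrite ?E ?primes_in_uniq ?primes_in_prime //.
have := @ram_expansion_selberg_sum_sqr R (sieve_primes j n) (level j) (sieve_range n)
    (primes_in_uniq _ _) (primes_in_prime _ _)
  (primes_in_gt _ (leqnn _)).
move=> /(ram_expansion_scale (selberg_mass R (sieve_primes j n) (sieve_range n))^-1).
by rewrite ger0_norm ?invr_ge0 ?selberg_mass_ge0 // mulVf // gt_eqF // sieve_mass_gt0.
Qed.

Lemma sqnorm_selberg_rest_le j n N g phi : (0 < a)%N -> (level_start j <= n)%N ->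
    (2 ^ n.+1 <= N)%N ->
  sqnorm (fun x => N%:R^-1 * orbit_sum (selberg_rest j n) N g phi x)
    <= 8 / (level_root j)%:R ^+ 3 * sqnorm phi.
Proof.
move=> a_gt0 jn nN; have Qr := level_le_sieve_range jn.
have E : level_primes j ++ sieve_primes j n = primes_in (level 0) (sieve_range n)
    by rewrite primes_in_cat // level_mono.
have := @sqnorm_ram_expansion_le R G (level_primes j ++ sieve_primes j n) 1 (level_root j)
    (prodn (level_primes j) * (sieve_range n * sieve_range n)) N
  (selberg_rest j n) g phi.
rewrite expr1n mulr1; apply=> //.
- by rewrite E primes_in_uniq.
- by rewrite E primes_in_prime.
- by rewrite E; apply: primes_in_gt; exact: level_ge1296 a_gt0.
- exact: level_root_gt0.
- rewrite level_root_sqr (leq_trans Qr) // mulnA leq_pmull // muln_gt0 prodn_level_primes_gt0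
    expn_gt0 //.
- apply: leq_trans nN; have [_ L16] := level_start_facts jn.
  rewrite -leq_sqr -expnM expnMn; apply: leq_trans (leq_mul L16 (leqnn _)) _.
  rewrite /sieve_range -expnD -expnM -expnD -[leqRHS]expnM leq_exp2l //.
  have := leq_trunc_div n 32; lia.
- exact: selberg_rest_expansion.
Qed.

End Norms.
End Scales.

(** * Majorizing the primes at one scale *)

Lemma leq_pow2_half m : (2 < m)%N -> (m.*2.+1 <= 2 ^ m)%N.
Proof.
elim: m => // m IH; rewrite ltnS leq_eqVlt => /orP[/eqP<-//|m2].
have := IH m2; rewrite expnS doubleS -muln2; lia.
Qed.

Lemma leq_n_pow2 n : (6 <= n)%N -> (n <= 2 ^ (n %/ 2))%N.
Proof.
move=> n6; have : (2 < n %/ 2)%N by rewrite leq_divRL.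
move=> /leq_pow2_half; apply: leq_trans; have := divn_eq n 2;
    have := ltn_pmod n (isT : 0 < 2)%N.
rewrite -muln2; lia.
Qed.

Section Pointwise.
Variable a : nat.
Hypothesis a_gt0 : (0 < a)%N.
Variables (R : realFieldType) (G : finZmodType) (g : G) (phi : G -> R).
Hypotheses (phi_ge0 : forall x, 0 <= phi x) (phi_le1 : forall x, phi x <= 1).

Local Notation b := (20 * a)%N.

(** The first multiple of the period of level [j] above [2^(n+1)]. *)
Definition window j n := ((2 ^ n.+1 %/ level_period a j).+1 * level_period a j)%N.

Lemma window_bounds j n : (level_start a j <= n)%N -> (2 ^ n.+1 <= window j n <= 2 ^ n.+2)%N.
Proof.
move=> jn; have P0 := level_period_gt0 a j; apply/andP; split.
  by rewrite ltnW // ltn_ceil.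
have Pn : (level_period a j <= 2 ^ n.+1)%N.
  have [jn32 L16] := level_start_facts jn.
  rewrite -leq_sqr /level_period -expnM expnMn; apply: leq_trans (leq_mul L16 (leqnn _)) _.
  rewrite /level -!expnM -expnD leq_exp2l //; lia.
have := leq_trunc_div (2 ^ n.+1) (level_period a j); rewrite /window mulSn [(2 ^ n.+2)%N]expnS;
    lia.
Qed.

Lemma count_prime_ge n N : (0 < n)%N -> (2 ^ n <= N)%N ->
  (2 ^ n.-1 <= n * count prime (iota 1 N))%N.
Proof.
move=> n0 nN; apply: leq_trans (chebyshev_lower n0) _; rewrite leq_mul2l; apply/orP; right.
by rewrite -(subnKC nN) iotaD count_cat leq_addr.
Qed.

(** The primes within the sieving range escape the majorant. Counted trivially,
    they are too few to matter for the threshold [2^(-a)]. *)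
Lemma small_primes_negligible n : (level_start a 0 <= n)%N ->
  (n * (2 ^ a * (sieve_range n).+1) <= 2 ^ (n - 2))%N.
Proof.
rewrite /level_start => n640.
apply: (@leq_trans (2 ^ (n %/ 2) * (2 ^ a * 2 ^ (n %/ 32).+1))).
  apply: leq_mul; first by apply: leq_n_pow2; lia.
  rewrite leq_mul2l; apply/orP; right; rewrite /sieve_range expnS.
  have : (0 < 2 ^ (n %/ 32))%N by rewrite expn_gt0.
  lia.
rewrite -!expnD leq_exp2l //.
have := leq_trunc_div n 2; have := leq_trunc_div n 32; lia.
Qed.

(** The harmonic sum up to the sieving range is at least a multiple of [n], and at
    most the product of the Euler factors up to [level j] with the mass. The
    factors up to [level 0] are the price for not sieving by them, and by Mertens'
    product this price is of order [a^2]. *)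
Lemma sieve_mass_ge j n : (level_start a j <= n)%N ->
  n%:R <= 384 * b%:R ^+ 2
    * (\prod_(p <- level_primes a j) (1 + p.-1%:R^-1)
       * selberg_mass R (sieve_primes a j n) (sieve_range n)) :> R.
Proof.
move=> jn; have Qr := level_le_sieve_range jn; have [jn32 _] := level_start_facts jn.
set V := \prod_(_ <- _) _; set h := selberg_mass _ _ _.
have Q0j : (level a 0 <= level a j)%N by apply: level_mono.
have E0 : primes_in 0 (level a 0) ++ level_primes a j = primes_in 0 (level a j).
  by rewrite primes_in_cat // Q0j.
have E1 : primes_in 0 (level a j) ++ sieve_primes a j n = primes_in 0 (sieve_range n).
  by rewrite primes_in_cat // Qr.
have harm : (n %/ 32)%:R / 2 <= \prod_(p <- primes_in 0 (level a 0)) (1 + p.-1%:R^-1) * V * h.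
  rewrite -big_cat E0; apply: le_trans (harmonic_ge R _) _.
  apply: harmonic_le_selberg_mass; rewrite E1 ?primes_in_uniq ?primes_in_prime //.
  by move=> p pp pr; rewrite mem_primes_in pp pr prime_gt0.
have V0 : 0 <= V by apply: prodr_ge0 => p _; rewrite addr_ge0 ?invr_ge0.
have h0 : 0 <= h by exact: selberg_mass_ge0.
have mert : \prod_(p <- primes_in 0 (level a 0)) (1 + p.-1%:R^-1) <= 3 * b%:R ^+ 2 :> R.
  have b2 : (2 < b)%N by lia.
  have := mertens_product_le R b2; rewrite /primes_in big_filter subn0.
  by rewrite /level muln0 addn0.
have n64 : n%:R <= 64 * (n %/ 32)%:R :> R.
  rewrite -natrM ler_nat; have := divn_eq n 32; have := ltn_pmod n (isT : 0 < 32)%N.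
  lia.
have : \prod_(p <- primes_in 0 (level a 0)) (1 + p.-1%:R^-1) * (V * h)
    <= 3 * b%:R ^+ 2 * (V * h).
  by rewrite ler_wpM2r ?mulr_ge0.
move: harm; rewrite -mulrA; lra.
Qed.

(** At a prime above the sieving range the rough weight equals its Euler product
    [V] and Selberg's sum equals its mass [h]. So [L S^2 / (V h^2)], which is
    nonnegative everywhere, equals [1] there. *)
Lemma prime_sum_le_majorant j n x : (level_start a j <= n)%N ->
  \sum_(0 <= m < window j n | prime m) phi (x + g *+ m)
  <= (sieve_range n).+1%:R
     + (\prod_(p <- level_primes a j) (1 + p.-1%:R^-1)
        * selberg_mass R (sieve_primes a j n) (sieve_range n))^-1
       * (orbit_sum (rough_weight R (level_primes a j)) (window j n) g phi x
          + orbit_sum (selberg_rest a R j n) (window j n) g phi x).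
Proof.
move=> jn; have Qr := level_le_sieve_range jn.
set V := \prod_(_ <- _) _; set h := selberg_mass _ _ _; set W := window j n.
have h0 : 0 < h by exact: sieve_mass_gt0.
have V0 : 0 < V.
  by apply: prodr_gt0 => p _; apply: ltr_pwDl; rewrite ?invr_ge0.
have sumr : \sum_(0 <= m < W) (m < (sieve_range n).+1)%N%:R <= (sieve_range n).+1%:R :> R.
  rewrite -natr_sum ler_nat -big_mkcond /= sum1_count.
  have -> : count (fun m => m < (sieve_range n).+1)%N (index_iota 0 W)
     = size [seq m <- index_iota 0 W | (m < (sieve_range n).+1)%N] by rewrite size_filter.
  rewrite -[leqRHS](size_iota 0); apply: uniq_leq_size.
    by rewrite filter_uniq // iota_uniq.
  by move=> m; rewrite mem_filter mem_iota => /andP[].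
rewrite /orbit_sum -big_split /= mulr_sumr.
apply: le_trans (lerD sumr (lexx _)); rewrite -big_split /= big_mkcond /=.
apply: ler_sum => m _.
have -> : rough_weight R (level_primes a j) m * phi (x + g *+ m) + selberg_rest a R j n m
    * phi (x + g *+ m)
   = rough_weight R (level_primes a j) m * h^-1 * selberg_sum R (sieve_primes a j n)
       (sieve_range n) m ^+ 2 * phi (x + g *+ m).
  by rewrite /selberg_rest -/h; field; rewrite gt_eqF.
have rest0 : 0 <= (V * h)^-1
    * (rough_weight R (level_primes a j) m * h^-1 * selberg_sum R (sieve_primes a j n)
    (sieve_range n) m ^+ 2
    * phi (x + g *+ m)).
  have hi : 0 <= h^-1 by rewrite invr_ge0 ltW.
  have := sqr_ge0 (selberg_sum R (sieve_primes a j n) (sieve_range n) m);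
      move: (_ ^+ 2) => S2 S20.
  by rewrite mulr_ge0 ?invr_ge0 ?mulr_ge0 ?rough_weight_ge0 ?(ltW V0) ?(ltW h0).
case: ifP => [pm|_]; last by rewrite addr_ge0.
case: leqP => [mr|rm]; last by rewrite ler_wpDr.
have cop y z : (z <= sieve_range n)%N -> all (fun p => ~~ (p %| m)%N) (primes_in y z).
  move=> zr; apply/allP => p; rewrite mem_primes_in => /and3P[pp _ pz].
  by rewrite dvdn_prime2 //; apply/eqP => E; lia.
rewrite add0r rough_weight_coprime ?cop // selberg_sum_coprime ?cop // -/V -/h.
rewrite le_eqVlt; apply/orP; left; apply/eqP; field; rewrite !gt_eqF //.
Qed.

End Pointwise.

(** * Covering the exceptional set *)

Lemma geometric_half (R : realFieldType) j :
  \sum_(0 <= i < j) (2 ^+ i)^-1 <= 2 :> R.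
Proof.
suff : \sum_(0 <= i < j) (2 ^+ i)^-1 <= 2 - 2 * (2 ^+ j)^-1 :> R.
  by move=> le; apply: le_trans le _; rewrite gerBl mulr_ge0 ?invr_ge0 ?exprn_ge0.
elim: j => [|j IH]; first by rewrite big_geq // expr0 invr1; lra.
by rewrite big_nat_recr //= exprS invfM; lra.
Qed.

Section Core.
Variable a : nat.
Hypothesis a_gt0 : (0 < a)%N.
Variables (R : realFieldType) (G : finZmodType) (g : G) (phi : G -> R).
Hypotheses (phi_ge0 : forall x, 0 <= phi x) (phi_le1 : forall x, phi x <= 1).

Local Notation b := (20 * a)%N.

(** The reciprocal of the threshold imposed on the averages of the majorant's parts. *)
Definition inv_threshold : R := 2 ^+ 15 * b%:R ^+ 2 * 2 ^+ a.
Definition prime_sum N x := \sum_(p <- iota 1 N | prime p) phi (x + g *+ p).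
Definition full_sum N x := \sum_(0 <= i < N) phi (x + g *+ i).

Lemma base_gt0 : 0 < b%:R :> R. Proof. by rewrite ltr0n; lia. Qed.
Lemma inv_threshold_gt0 : 0 < inv_threshold.
Proof. by rewrite /inv_threshold !mulr_gt0 ?exprn_gt0 ?base_gt0. Qed.

Lemma prime_sum_le_full_window N W x : (N < W)%N ->
  prime_sum N x <= \sum_(0 <= m < W | prime m) phi (x + g *+ m).
Proof.
move=> NW; rewrite [leRHS](@big_cat_nat _ _ _ N.+1) //= ler_wpDr ?sumr_ge0 //.
by rewrite [leRHS]big_ltn_cond // /= /index_iota subSS subn0.
Qed.

(** By Chebyshev's lower bound the sum over primes exceeds [2^(-a) 2^(n-1) / n], and
    half of this survives the removal of the primes in the sieving range. The
    majorant has weight at most [384 b^2 / n] by [sieve_mass_ge], so that the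
    factors [n] cancel. *)
Lemma scale_lower j n N x : (level_start a j <= n)%N -> (2 ^ n <= N < 2 ^ n.+1)%N ->
  (count prime (iota 1 N))%:R < 2 ^+ a * prime_sum N x ->
  4 * (window a j n)%:R
    < inv_threshold
      * (orbit_sum (rough_weight R (level_primes a j)) (window a j n) g phi x
         + orbit_sum (selberg_rest a R j n) (window a j n) g phi x).
Proof.
move=> jn /andP[nN Nn] big_x.
set W := window a j n; set Y := _ + _.
have [jn32 _] := level_start_facts jn.
have n640 : (640 <= n)%N by lia.
have nj0n : (level_start a 0 <= n)%N by rewrite /level_start; lia.
have /andP[W1 W2] := window_bounds a_gt0 jn.
have := prime_sum_le_majorant a_gt0 g phi_ge0 phi_le1 x jn; rewrite -/W -/Y.
have := sieve_mass_ge a_gt0 R jn.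
set VH := (X in _ <= _ * X); move=> mass sumle.
have VH0 : 0 < VH.
  rewrite /VH mulr_gt0 ?sieve_mass_gt0 //; apply: prodr_gt0 => p _.
  by apply: ltr_pwDl; rewrite ?invr_ge0.
have {sumle}sumle := le_trans (prime_sum_le_full_window x (leq_trans Nn W1)) sumle.
have cge : 2 * 2 ^+ (n - 2) <= n%:R * (count prime (iota 1 N))%:R :> R.
  rewrite -exprS -natrX -natrM ler_nat.
  have := count_prime_ge (leq_trans (isT : 0 < 640)%N n640) nN.
  by have -> : (n - 2).+1 = n.-1 by lia.
have small : n%:R * (2 ^+ a * (sieve_range n).+1%:R) <= 2 ^+ (n - 2) :> R.
  rewrite -!natrX -!natrM ler_nat; exact (small_primes_negligible a_gt0 nj0n).
have Wle : W%:R <= 16 * 2 ^+ (n - 2) :> R.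
  rewrite -natrX -natrM ler_nat; apply: leq_trans W2 _.
  by rewrite (_ : 16 = 2 ^ 4)%N // -expnD leq_exp2l //; lia.
have n0 : 0 < n%:R :> R by rewrite ltr0n; lia.
have A0 : 0 < 2 ^+ a :> R by rewrite exprn_gt0.
have B0 := base_gt0.
rewrite /inv_threshold; move: (2 ^+ a) A0 big_x small => A A0 big_x small.
have p20 : 0 < 2 ^+ (n - 2) :> R by rewrite exprn_gt0.
move: (2 ^+ (n - 2)) p20 cge small Wle => p2 p20 cge small Wle.
have step : p2 < n%:R * A * (VH^-1 * Y).
  have : n%:R * (count prime (iota 1 N))%:R < n%:R * (A * prime_sum N x) by rewrite ltr_pM2l.
  have : n%:R * (A * prime_sum N x) <= n%:R * (A * ((sieve_range n).+1%:R + VH^-1 * Y)).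
    by rewrite ler_pM2l // ler_pM2l.
  move: small cge; rewrite mulrDr mulrDr; move: (A * _) (n%:R * _) => u v.
  by rewrite -!mulrA; lra.
have Y0 : 0 < Y.
  have : 0 < n%:R * A * VH^-1 * Y by rewrite -mulrA; lra.
  have c0 : 0 < n%:R * A * VH^-1 by rewrite divr_gt0 // mulr_gt0.
  by rewrite (pmulr_rgt0 Y c0).
have nVH : n%:R * VH^-1 <= 384 * b%:R ^+ 2 by rewrite ler_pdivrMr.
have : n%:R * A * (VH^-1 * Y) <= 384 * b%:R ^+ 2 * (A * Y).
  have -> : n%:R * A * (VH^-1 * Y) = n%:R * VH^-1 * (A * Y) by ring.
  by rewrite ler_wpM2r // mulr_ge0 // ltW.
have Z0 : 0 < b%:R ^+ 2 * (A * Y) by rewrite !mulr_gt0.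
have -> : 2 ^+ 15 * b%:R ^+ 2 * A * Y = 2 ^+ 15 * (b%:R ^+ 2 * (A * Y)) by ring.
rewrite -[384 * _ * _]mulrA; move: (b%:R ^+ 2 * _) Z0 => Z Z0 le; lra.
Qed.

Lemma orbit_sum_rough_weight j W x :
  orbit_sum (rough_weight R (level_primes a j)) W g phi x
      = full_sum W x + \sum_(0 <= i < j) orbit_sum (rough_step a R i) W g phi x.
Proof.
rewrite /orbit_sum exchange_big /= /full_sum -big_split /=; apply: eq_bigr => m _.
by rewrite rough_weight_telescope mulrDl mul1r mulr_suml.
Qed.

(** The four units of mass granted by [scale_lower] are shared out: one to the
    plain average, one to the rest, and two to the steps, because the thresholds
    [2^(-i)] sum to at most [2]. *)
Lemma scale_cases j n N x : (level_start a j <= n)%N -> (2 ^ n <= N < 2 ^ n.+1)%N ->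
  (count prime (iota 1 N))%:R < 2 ^+ a * prime_sum N x ->
  [\/ inv_threshold^-1 * (window a j n)%:R < full_sum (window a j n) x,
      exists2 i, (i < j)%N &
        inv_threshold^-1 * (2 ^+ i)^-1 * (window a j n)%:R
            < `|orbit_sum (rough_step a R i) (window a j n) g phi x|
    | inv_threshold^-1 * (window a j n)%:R
        < `|orbit_sum (selberg_rest a R j n) (window a j n) g phi x|].
Proof.
move=> jn nN big_x; have := scale_lower jn nN big_x; set W := window a j n.
rewrite orbit_sum_rough_weight; have t0 := inv_threshold_gt0.
rewrite -(ltr_pM2l (x := inv_threshold^-1)) ?invr_gt0 // mulKf ?gt_eqF // => low.
have W0 : 0 <= inv_threshold^-1 * W%:R by rewrite mulr_ge0 ?invr_ge0 ?(ltW t0).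
have [c1|c1] := ltP (inv_threshold^-1 * W%:R) (full_sum W x); first by constructor 1.
have [c3|c3] := ltP (inv_threshold^-1 * W%:R) `|orbit_sum (selberg_rest a R j n) W g phi x|;
    first by constructor 3.
have [/hasP[i]|none] := boolP (has (fun i => inv_threshold^-1 * (2 ^+ i)^-1 * W%:R
    < `|orbit_sum (rough_step a R i) W g phi x|) (index_iota 0 j)).
  by rewrite mem_index_iota => /= ij c2; constructor 2; exists i.
have : \sum_(0 <= i < j) orbit_sum (rough_step a R i) W g phi x
    <= \sum_(0 <= i < j) inv_threshold^-1 * W%:R * (2 ^+ i)^-1.
  rewrite big_seq [leRHS]big_seq; apply: ler_sum => i /(hasPn none).
  by rewrite -leNgt mulrAC => le; apply: le_trans (ler_norm _) le.
rewrite -mulr_sumr => c2.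
have := ler_wpM2l W0 (geometric_half R j).
have := ler_norm (orbit_sum (selberg_rest a R j n) W g phi x).
by move: low; rewrite mulrCA; lra.
Qed.

Variable Nmax : nat.

Definition max_window := (4 * Nmax.+1)%N.
Definition large_average := [set x | [exists m : 'I_(max_window),
  inv_threshold^-1 * m.+1%:R < full_sum m.+1 x]].
Definition large_step i := [set x | [exists m : 'I_(max_window),
  inv_threshold^-1 * (2 ^+ i)^-1 * (m.+1 * level_period a i.+1)%:R
      < `|orbit_sum (rough_step a R i) (m.+1 * level_period a i.+1) g phi x|]].
Definition large_rest j n := [set x | inv_threshold^-1
  < `|(window a j n)%:R^-1 * orbit_sum (selberg_rest a R j n) (window a j n) g phi x|].

(** The division-free form of the condition that some average over primes exceeds
    [2^(-a)]. *)
Definition exceptional := [set x | [exists N : 'I_Nmax,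
  (count prime (iota 1 N))%:R < 2 ^+ a * prime_sum N x]].

(** Below the first level the factor [n] in Chebyshev's lower bound is at most a
    multiple of [a], and the primes are simply majorized by all the integers. Above
    it, every scale belongs to exactly one level and [scale_cases] applies. *)
Lemma exceptional_cover : exceptional \subset
  large_average :|: [set x | has (fun i => x \in large_step i) (iota 0 Nmax)]
  :|: [set x | has (fun j => x \in
         [set x | has (fun n => x \in large_rest j n)
             (index_iota (level_start a j) (level_start a j.+1))]) (iota 0 Nmax)].
Proof.
apply/subsetP => x; rewrite inE => /existsP[[N NN] /= big_x].
have t0 := inv_threshold_gt0.
have [N1|N1] := leqP N 1.
  move: big_x; rewrite /prime_sum; case: N N1 {NN} => [|[|]] //= _.
    by rewrite big_nil mulr0 ltxx.
  by rewrite big_cons big_nil /= mulr0 ltxx.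
pose n := trunc_log 2 N.
have /andP[nN Nn] : (2 ^ n <= N < 2 ^ n.+1)%N by apply: trunc_log_bounds => //; exact: ltnW.
have n0 : (0 < n)%N by rewrite /n trunc_log_gt0.
have nNmax : (n < Nmax)%N by apply: leq_ltn_trans NN; apply: leq_trans nN;
    rewrite ltnW // ltn_expl.
have toA W : (0 < W <= max_window)%N -> inv_threshold^-1 * W%:R < full_sum W x ->
    x \in large_average.
  case: W => // W /= WK lt; rewrite inE; apply/existsP; exists (Ordinal WK); exact: lt.
have [small|large] := ltnP n (level_start a 0).
  rewrite !inE; apply/orP; left; apply/orP; left.
  have := toA N.+1; rewrite inE; apply; first by rewrite /max_window; lia.
  have cge : 2 ^+ n.-1 <= n%:R * (count prime (iota 1 N))%:R :> R.
    by rewrite -natrX -natrM ler_nat count_prime_ge.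
  have pc : prime_sum N x <= full_sum N.+1 x.
    apply: le_trans (prime_sum_le_full_window x (ltnSn N)) _.
    rewrite big_mkcond; apply: ler_sum => m _; by case: ifP.
  have NW : N.+1%:R <= 4 * 2 ^+ n.-1 :> R.
    rewrite -natrX -natrM ler_nat; apply: leq_trans Nn _.
    by case: (n) n0 => //= k _; rewrite !expnS mulnA.
  have nb : n%:R <= 32 * b%:R :> R by rewrite -natrM ler_nat; apply: ltnW.
  have b1 : 1 <= b%:R :> R by rewrite ler1n; lia.
  have A0 : 0 < 2 ^+ a :> R by rewrite exprn_gt0.
  rewrite mulrC ltr_pdivrMr // /inv_threshold.
  have n0' : 0 < n%:R :> R by rewrite ltr0n.
  have c0 : 0 <= full_sum N.+1 x by apply: sumr_ge0.
  move: (2 ^+ a) A0 big_x => A A0 big_x.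
  have s1 : n%:R * (count prime (iota 1 N))%:R < n%:R * (A * prime_sum N x) by rewrite ltr_pM2l.
  have s2 : n%:R * (A * prime_sum N x) <= 32 * b%:R * (A * full_sum N.+1 x).
    rewrite ler_pM ?(ltW n0') //; last by rewrite ler_pM2l.
    by rewrite mulr_ge0 ?(ltW A0) // sumr_ge0.
  have s3 : b%:R * (A * full_sum N.+1 x) <= b%:R ^+ 2 * (A * full_sum N.+1 x).
    by rewrite ler_wpM2r ?mulr_ge0 ?(ltW A0) // ler_eXnr.
  have -> : full_sum N.+1 x * (2 ^+ 15 * b%:R ^+ 2 * A)
      = 2 ^+ 15 * (b%:R ^+ 2 * (A * full_sum N.+1 x)).
    by ring.
  have s4 : 0 <= b%:R ^+ 2 * (A * full_sum N.+1 x) by rewrite !mulr_ge0 ?sqr_ge0 ?(ltW A0).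
  move: s2 s3 s4; rewrite -[32 * _ * _]mulrA.
  move: (b%:R ^+ 2 * _) (b%:R * _) => u v; lra.
have [j /andP[jn nj1]] := level_exists large.
have jN : (j < Nmax)%N by apply: leq_ltn_trans nNmax; apply: leq_trans jn;
    exact: level_start_ge_index.
have /andP[W1 W2] := window_bounds a_gt0 jn.
have W0 : (0 < window a j n)%N by apply: leq_trans W1; rewrite expn_gt0.
have WK : (window a j n <= max_window)%N.
  apply: leq_trans W2 _; rewrite /max_window !expnS; lia.
rewrite !inE; case: (scale_cases jn (introT andP (conj nN Nn)) big_x) => [c1|[i ij c2]|c3].
- apply/orP; left; apply/orP; left; have := toA _ _ c1; rewrite inE; apply.
  by rewrite W0.
- apply/orP; left; apply/orP; right; apply/hasP; exists i.
    by rewrite mem_iota /=; lia.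
  have Pd : (level_period a i.+1 %| window a j n)%N by rewrite dvdn_mull // level_period_dvd.
  case/dvdnP: Pd => k Wk; rewrite inE; apply/existsP.
  have k0 : (0 < k)%N by move: W0; rewrite Wk; case: (k).
  have kK : (k.-1 < max_window)%N.
    by rewrite prednK //; apply: leq_trans WK; rewrite Wk leq_pmulr // level_period_gt0.
  by exists (Ordinal kK); rewrite /= prednK // -Wk.
- apply/orP; right; apply/hasP; exists j; first by rewrite mem_iota /=; lia.
  rewrite inE; apply/hasP; exists n; first by rewrite mem_index_iota jn.
  have W0' : 0 < (window a j n)%:R :> R by rewrite ltr0n.
  by rewrite inE normrM ger0_norm ?invr_ge0 // mulrC ltr_pdivlMr.
Qed.

End Core.

(** * Cardinality of the exceptional set *)

Section CoreCount.
Variable a : nat.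
Hypothesis a_gt0 : (0 < a)%N.
Variables (R : realFieldType) (G : finZmodType) (g : G) (phi : G -> R).
Hypotheses (phi_ge0 : forall x, 0 <= phi x) (phi_le1 : forall x, phi x <= 1).
Variable Nmax : nat.

Local Notation thr := (inv_threshold a R).
Local Notation S := (\sum_x phi x).
Local Notation X := (2 ^+ (10 * a) : R).

Definition threshold_const : R := 2 ^+ 15 * 400.
Definition core_const : R := threshold_const + 2 ^+ 19 * threshold_const ^+ 2.

Lemma threshold_const_gt0 : 0 < threshold_const.
Proof. by apply: mulr_gt0; [apply: exprn_gt0; exact: ltr0n|exact: ltr0n]. Qed.

Lemma core_const_gt0 : 0 < core_const.
Proof.
apply: addr_gt0; first exact: threshold_const_gt0.
by apply: mulr_gt0; [apply: exprn_gt0; exact: ltr0n|exact: exprn_gt0 threshold_const_gt0].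
Qed.

Lemma mass_ge0 : 0 <= S. Proof. exact: sumr_ge0. Qed.

Lemma sqnorm_le_mass : sqnorm phi <= S.
Proof. by apply: ler_sum => x _; rewrite expr2 ler_piMl. Qed.

Lemma base_pow_gt0 : 0 < X. Proof. by rewrite exprn_gt0. Qed.

Lemma base_pow_ge1 : 1 <= X. Proof. by rewrite exprn_ege1 // ler1n. Qed.

Lemma level_rootE j : (level_root a j)%:R = X * 4 ^+ j :> R.
Proof. by rewrite /level_root expnD natrM !natrX (exprM _ 2 j) -(natrX _ 2 2). Qed.

Lemma card_large_average : #|large_average a g phi Nmax|%:R <= thr * S.
Proof.
have t0 := inv_threshold_gt0 a_gt0 R.
have := @maximal_count R G phi g thr^-1 (max_window Nmax) phi_ge0.
by rewrite invrK invr_gt0; apply.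
Qed.

Lemma card_large_step i : #|large_step a g phi Nmax i|%:R <= 8 * thr ^+ 2 / X * S * (2 ^+ i)^-1.
Proof.
have t0 := inv_threshold_gt0 a_gt0 R; have X0 := base_pow_gt0; have X1 := base_pow_ge1.
have u0 : 0 < thr^-1 * (2 ^+ i)^-1 by rewrite mulr_gt0 ?invr_gt0 ?exprn_gt0.
have A := sqnorm_rough_step_le i g phi a_gt0.
apply: le_trans (periodic_maximal_count (max_window Nmax) (level_period_gt0 a i.+1) u0
   (rough_step_periodic a R i) A) _.
rewrite level_rootE; have i0 : 1 <= 2 ^+ i :> R by rewrite exprn_ege1 // ler1n.
have -> : 4 ^+ i = 2 ^+ i * 2 ^+ i :> R by rewrite -exprMn -natrM.
move: (2 ^+ i) i0 => y y1; have y0 : 0 < y by lra.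
have -> : (thr^-1 * y^-1) ^- 2 * (8 / (X * (y * y)) ^+ 3 * sqnorm phi)
    = 8 * thr ^+ 2 / X / y * ((X ^+ 2 * y ^+ 3)^-1 * sqnorm phi).
  by field; rewrite !gt_eqF.
have -> : 8 * thr ^+ 2 / X * S * y^-1 = 8 * thr ^+ 2 / X / y * S by ring.
apply: ler_wpM2l.
  by rewrite divr_ge0 ?(ltW y0) // divr_ge0 ?(ltW X0) // mulr_ge0 ?sqr_ge0.
apply: le_trans sqnorm_le_mass; rewrite ler_piMl ?sqnorm_ge0 // invf_le1.
  by rewrite mulr_ege1 // exprn_ege1.
by rewrite mulr_gt0 ?exprn_gt0.
Qed.

Lemma card_large_rest j n : (level_start a j <= n)%N ->
  #|large_rest a g phi j n|%:R <= 8 * thr ^+ 2 / (X * 4 ^+ j) ^+ 3 * S.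
Proof.
move=> jn; have t0 := inv_threshold_gt0 a_gt0 R; have t1 : 0 < thr^-1 by rewrite invr_gt0.
have /andP[W1 _] := window_bounds a_gt0 jn.
have := chebyshev_count (fun x => (window a j n)%:R^-1
   * orbit_sum (selberg_rest a R j n) (window a j n) g phi x) t1.
have := sqnorm_selberg_rest_le g phi a_gt0 jn W1; rewrite -level_rootE.
rewrite -/(large_rest a g phi j n); set c := #|_|%:R; set s := (_ ^+ 3).
have s0 : 0 < s by rewrite exprn_gt0 // ltr0n level_root_gt0.
move=> le1 le2; have le3 := le_trans le2 le1.
have le4 : 8 / s * sqnorm phi <= 8 / s * S.
  by rewrite ler_wpM2l ?sqnorm_le_mass // divr_ge0 // ltW.
rewrite exprVn in le3; have := le_trans le3 le4; rewrite ler_pdivrMl ?exprn_gt0 //.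
by have -> : 8 * thr ^+ 2 / s * S = thr ^+ 2 * (8 / s * S) by ring.
Qed.

Lemma level_start_succ_le j : (level_start a j.+1)%:R <= 512 * 24 * a%:R * 2 ^+ j
    * (X * 4 ^+ j) ^+ 2 :> R.
Proof.
rewrite -level_rootE -!natrX level_root_sqr.
have -> : level_start a j.+1 = (32 * (20 * a + 4 * j.+1) * (16 * level a j))%N.
  by rewrite /level_start /level (_ : 20 * a + 4 * j.+1 = 4 + (20 * a + 4 * j))%N ?expnD; lia.
have le1 : (20 * a + 4 * j.+1 <= 24 * (a * 2 ^ j))%N.
  have := ltn_expl j (isT : 1 < 2)%N; nia.
rewrite -!natrM ler_nat mulnA leq_mul2r; apply/orP; right.
by move: (2 ^ j)%N le1 => y; nia.
Qed.

(** Level [j] serves about [(a + j) level j] scales, while each costs the power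
    [-3/2] of [level j]; the power [-1/2] that remains decreases geometrically in
    [j]. *)
Lemma sum_card_large_rest j :
  \sum_(level_start a j <= n < level_start a j.+1) #|large_rest a g phi j n|%:R
  <= 8 * 512 * 24 * a%:R * thr ^+ 2 / X * S * (2 ^+ j)^-1.
Proof.
apply: (@le_trans _ _ (\sum_(level_start a j <= n < level_start a j.+1) 8 * thr ^+ 2
    / (X * 4 ^+ j) ^+ 3 * S)).
  by apply: ler_sum_nat => n /andP[jn _]; exact: card_large_rest.
have S0 := mass_ge0; have X0 := base_pow_gt0; have t0 := inv_threshold_gt0 a_gt0 R.
have j0 : 0 < 2 ^+ j :> R by rewrite exprn_gt0.
rewrite sumr_const_nat -[leLHS]mulr_natl.
apply: (@le_trans _ _ (512 * 24 * a%:R * 2 ^+ j * (X * 4 ^+ j) ^+ 2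
   * (8 * thr ^+ 2 / (X * 4 ^+ j) ^+ 3 * S))).
  rewrite ler_wpM2r //; last first.
    by apply: le_trans (level_start_succ_le j); rewrite ler_nat leq_subr.
  by rewrite mulr_ge0 // divr_ge0 ?mulr_ge0 ?exprn_ge0 // ?sqr_ge0 // ltW.
have -> : 4 ^+ j = 2 ^+ j * 2 ^+ j :> R by rewrite -exprMn -natrM.
move: (2 ^+ j) j0 => y y0; rewrite le_eqVlt; apply/orP; left; apply/eqP.
by field; rewrite !gt_eqF.
Qed.

(** The plain averages contribute the main term. The steps and the rests gain a
    factor [2^(-10a)] over the square of the inverse threshold, and this outweighs
    all the powers of [a] and [2^a] that come with it. *)
Theorem exceptional_card_le :
  #|exceptional a g phi Nmax|%:R <= core_const * (a%:R ^+ 2 * 2 ^+ a) * S.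
Proof.
have S0 := mass_ge0; have X0 := base_pow_gt0; have t0 := inv_threshold_gt0 a_gt0 R.
have q0 : 0 <= thr ^+ 2 / X * S by rewrite mulr_ge0 // divr_ge0 ?sqr_ge0 // ltW.
have := subset_leq_card (exceptional_cover a_gt0 g phi_ge0 phi_le1 Nmax).
set B := [set x | has _ _]; set C := [set x | has _ _] => cover.
have {}cover : #|exceptional a g phi Nmax|%:R
   <= #|large_average a g phi Nmax|%:R + #|B|%:R + #|C|%:R :> R.
  rewrite -!natrD ler_nat; apply: leq_trans cover _.
  apply: leq_trans (leq_card_setU _ _) _; rewrite leq_add2r; exact: leq_card_setU.
have cB : #|B|%:R <= 16 * thr ^+ 2 / X * S.
  have : #|B|%:R <= \sum_(i <- iota 0 Nmax) #|large_step a g phi Nmax i|%:R :> R.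
    by rewrite -natr_sum ler_nat card_has.
  move/le_trans; apply; apply: (@le_trans _ _
    (\sum_(0 <= i < Nmax) 8 * thr ^+ 2 / X * S * (2 ^+ i)^-1)).
    rewrite /index_iota subn0; apply: ler_sum => i _; exact: card_large_step.
  rewrite -mulr_sumr; have := geometric_half R Nmax.
  have c0 : 0 <= 8 * thr ^+ 2 / X * S.
    have -> : 8 * thr ^+ 2 / X * S = 8 * (thr ^+ 2 / X * S) by ring.
    by rewrite mulr_ge0.
  move=> /(ler_wpM2l c0); move: c0; rewrite -!mulrA; lra.
have cC : #|C|%:R <= 2 ^+ 18 * a%:R * thr ^+ 2 / X * S.
  have : #|C|%:R <= \sum_(j <- iota 0 Nmax) \sum_(level_start a j <= n < level_start a j.+1)
      #|large_rest a g phi j n|%:R :> R.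
    rewrite -(eq_bigr _ (fun j _ => natr_sum _ _ _ _)) -natr_sum ler_nat.
    by apply: leq_trans (card_has _ _) _; apply: leq_sum => j _; exact: card_has.
  move/le_trans; apply; apply: (@le_trans _ _
    (\sum_(0 <= j < Nmax) 8 * 512 * 24 * a%:R * thr ^+ 2 / X * S * (2 ^+ j)^-1)).
    rewrite /index_iota subn0; apply: ler_sum => i _; exact: sum_card_large_rest.
  rewrite -mulr_sumr; have := geometric_half R Nmax.
  have c0 : 0 <= 8 * 512 * 24 * a%:R * thr ^+ 2 / X * S.
    have -> : 8 * 512 * 24 * a%:R * thr ^+ 2 / X * S
       = 8 * 512 * 24 * a%:R * (thr ^+ 2 / X * S) by ring.
    by apply: mulr_ge0; [rewrite -!natrM; exact: ler0n|exact: q0].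
  move=> /(ler_wpM2l c0) le; apply: le_trans le _.
  by move: c0; rewrite -!mulrA; lra.
have cA := card_large_average.
pose A : R := 2 ^+ a.
have a1 : 1 <= a%:R :> R by rewrite ler1n.
have aA : a%:R <= A by rewrite /A -natrX ler_nat ltnW // ltn_expl.
have tauE : thr = threshold_const * (a%:R ^+ 2 * A).
  by rewrite /inv_threshold /threshold_const /A natrM; ring.
have XE : X = A ^+ 10 by rewrite /A -exprM mulnC.
have A1 : 1 <= A by apply: le_trans aA.
have A0 : 0 < A by lra.
(* [a (a^2 2^a)^2 <= 2^(7a)] by [a <= 2^a], and [X = 2^(10a)]. *)
have key : a%:R * thr ^+ 2 / X <= threshold_const ^+ 2.
  rewrite ler_pdivrMr // tauE XE.
  have -> : a%:R * (threshold_const * (a%:R ^+ 2 * A)) ^+ 2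
      = threshold_const ^+ 2 * (a%:R ^+ 5 * A ^+ 2) by ring.
  rewrite ler_wpM2l ?sqr_ge0 //.
  apply: (@le_trans _ _ (A ^+ 5 * A ^+ 2)).
    by rewrite ler_wpM2r ?sqr_ge0 // lerXn2r ?nnegrE ?(ltW A0).
  by rewrite -exprD ler_weXn2l.
have key1 : thr ^+ 2 / X <= a%:R * thr ^+ 2 / X.
  by rewrite -mulrA ler_peMl // divr_ge0 ?sqr_ge0 // ltW.
have Z1 : 1 <= a%:R ^+ 2 * A by rewrite mulr_ege1 // exprn_ege1.
rewrite -/A; apply: le_trans cover _.
apply: (@le_trans _ _ ((thr + 2 ^+ 19 * (a%:R * thr ^+ 2 / X)) * S)).
  have yz : thr ^+ 2 / X * S <= a%:R * thr ^+ 2 / X * S by rewrite ler_wpM2r.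
  have z0 := le_trans q0 yz; rewrite [leRHS]mulrDl; move: cA cB cC.
  have -> : 16 * thr ^+ 2 / X * S = 16 * (thr ^+ 2 / X * S) by ring.
  have -> : 2 ^+ 18 * a%:R * thr ^+ 2 / X * S = 2 ^+ 18 * (a%:R * thr ^+ 2 / X * S) by ring.
  rewrite -[2 ^+ 19 * _ * S]mulrA; move: yz z0.
  move: (thr ^+ 2 / X * S) (a%:R * thr ^+ 2 / X * S) => y z; lra.
rewrite ler_wpM2r //.
have -> : core_const * (a%:R ^+ 2 * A)
    = thr + 2 ^+ 19 * (threshold_const ^+ 2 * (a%:R ^+ 2 * A)).
  by rewrite tauE /core_const; ring.
rewrite lerD2l ler_wpM2l ?exprn_ge0 //.
by apply: le_trans key _; rewrite ler_peMr ?sqr_ge0.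
Qed.

End CoreCount.

(** * Transference to a finite group *)

Section Transference.

Lemma common_bound (T : eqType) (s : seq T) (P : T -> nat -> Prop) :
  {in s, forall x, exists N, P x N} ->
  exists B, {in s, forall x, exists2 N, (N < B)%N & P x N}.
Proof.
elim: s => [|x s IH] H; first by exists 0%N.
have [N PN] := H x (mem_head _ _).
have [B HB] : exists B, {in s, forall x, exists2 N, (N < B)%N & P x N}.
  by apply: IH => y ys; apply: H; rewrite inE ys orbT.
exists (maxn N.+1 B) => y; rewrite inE => /orP[/eqP->|/HB[M MB PM]].
  by exists N => //; rewrite leq_maxl.
by exists M => //; rewrite leq_max MB orbT.
Qed.

Lemma intr_mod_inj (m : nat) (s : seq int) : {in s, forall x, (`|x| <= m)%N} ->
  {in s &, injective (fun x : int => x%:~R : 'I_(m.*2).+2)}.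
Proof.
move=> sm x y xs ys /eqP; rewrite -subr_eq0 -intrB => /eqP E.
have D0 : (`|x - y|%N)%:R = 0 :> 'I_(m.*2).+2.
  have : (`|x - y|%N : int)%:~R = 0 :> 'I_(m.*2).+2.
    rewrite abszE; case: (intP (x - y)) E => [|n|n] //=.
    by rewrite rmorphN /= => /eqP; rewrite oppr_eq0 => /eqP E; rewrite normrN.
  by [].
have lt : (`|x - y| < m.*2.+2)%N.
  have := sm _ xs; have := sm _ ys; rewrite -addnn; lia.
move: D0; rewrite Zp_nat => /(congr1 val) /=; rewrite modn_small // => /eqP.
by rewrite absz_eq0 subr_eq0 => /eqP.
Qed.

(** Reduction modulo a large integer maps averages to averages, does not decrease
    the indicator of the finite set, and is injective on the finitely many points
    to be counted. *)
Lemma transference (R : realFieldType) a (s Fs : seq int) : (0 < a)%N -> uniq s ->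
  {in s, forall x, exists N, (count prime (iota 1 N))%:R
      < 2 ^+ a * \sum_(p <- iota 1 N | prime p) (x + p%:Z \in Fs)%:R :> R} ->
  (size s)%:R <= core_const R * (a%:R ^+ 2 * 2 ^+ a) * (size Fs)%:R :> R.
Proof.
move=> a0 us /common_bound[Nmax HN].
have [m sm] : exists m, {in s, forall x : int, (`|x| <= m)%N}.
  have [|B HB] := @common_bound _ s (fun x N => N = `|x|%N).
    by move=> x _; exists `|x|%N.
  by exists B => x /HB[N NB <-]; exact: ltnW.
pose G := 'I_(m.*2).+2; pose io (x : int) : G := x%:~R.
pose Fi : seq G := [seq io z | z <- Fs].
pose phi (y : G) : R := (y \in Fi)%:R.
have phi0 y : 0 <= phi y by rewrite ler0n.
have phi1 y : phi y <= 1 by rewrite lern1 leq_b1.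
have mass : \sum_y phi y <= (size Fs)%:R.
  rewrite -natr_sum ler_nat -big_mkcond /= sum1_card.
  by apply: leq_trans (card_size _) _; rewrite size_map.
apply: le_trans (_ : core_const R * (a%:R ^+ 2 * 2 ^+ a) * \sum_y phi y <= _); last first.
  apply: ler_wpM2l => //; apply: mulr_ge0; first exact: ltW (core_const_gt0 R).
  by apply: mulr_ge0; [exact: sqr_ge0|exact: exprn_ge0].
apply: le_trans (exceptional_card_le a0 (1 : G) phi0 phi1 Nmax).
rewrite ler_nat -(size_map io) -(card_uniqP _); last first.
  by rewrite map_inj_in_uniq //; exact: intr_mod_inj.
apply: subset_leq_card; apply/subsetP => _ /mapP[x xs ->].
have [N NN big_x] := HN x xs; rewrite inE; apply/existsP; exists (Ordinal NN) => /=.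
apply: lt_le_trans big_x _; rewrite ler_wpM2l ?exprn_ge0 //.
apply: ler_sum => p _; rewrite ler_nat; case: (boolP (_ \in Fs)) => // xF.
have -> : io x + 1 *+ p = io (x + p%:Z) by rewrite /io intrD.
by rewrite map_f.
Qed.

End Transference.

(** * The estimate on the integers *)

(** A bound for all the finite subsets also forces the set to be finite. *)
Lemma counting_le (T : choiceType) (R : realType) (A : set T) (B : R) :
  (forall s : seq T, uniq s -> {in s, forall x, A x} -> (size s)%:R <= B) ->
  (counting A <= B%:E)%E.
Proof.
move=> H; rewrite /counting; case: asboolP => [finA|infA].
  rewrite lee_fin; apply: H; first exact: fset_uniq.
  by move=> x; rewrite in_fset_set // => /set_mem.
exfalso; have [s sA] := infinite_set_fset (Num.bound `|B|) infA.
apply/negP; rewrite -ltnNge -(ltr_nat R).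
apply: le_lt_trans (H s _ _) _; first exact: fset_uniq.
  by move=> x xs; apply: sA.
by apply: le_lt_trans (ler_norm B) _; exact: archi_boundP.
Qed.

(** Take [2^(a-1)] to be the largest power of [2] up to the integer part of
    [1 / lambda]. Then [a - 1] is at most [ln (1 / lambda) / ln 2], and
    [ln (e / lambda) >= 1] absorbs the remaining unit. *)
Lemma dyadic_level (R : realType) (lambda : R) : 0 < lambda -> lambda < 1 ->
  exists a : nat, [/\ (0 < a)%N, 1 < lambda * 2 ^+ a, 2 ^+ a <= 2 * lambda^-1
    & a%:R <= (1 + (ln 2)^-1) * ln (expR 1 / lambda)].
Proof.
move=> l0 l1; have il1 : 1 <= lambda^-1 by rewrite invf_ge1 // ltW.
have [m0 m1] : (Num.truncn lambda^-1)%:R <= lambda^-1 /\ lambda^-1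
    < (Num.truncn lambda^-1).+1%:R.
  by apply/andP; rewrite truncn_itv // invr_ge0 ltW.
set m := Num.truncn _ in m0 m1.
have mpos : (0 < m)%N by rewrite truncn_gt0.
have /andP[t0 t1] := trunc_log_bounds (isT : 1 < 2)%N mpos.
set k := trunc_log 2 m in t0 t1.
have k0 : 2 ^+ k <= lambda^-1 by apply: le_trans m0; rewrite -natrX ler_nat.
have ln2 : 0 < ln 2 :> R by rewrite ln_gt0 // ltr1n.
exists k.+1; split => //.
- rewrite mulrC -ltr_pdivrMr // mul1r; apply: lt_le_trans m1 _.
  by rewrite -natrX ler_nat.
- by rewrite exprS ler_pM2l.
- rewrite ln_div ?posrE ?expR_gt0 // expRK -lnV ?posrE //.
  have kl : k%:R * ln 2 <= ln lambda^-1.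
    rewrite mulr_natl -lnXn // ler_ln ?posrE ?exprn_gt0 ?invr_gt0 //.
  have kl' : k%:R <= (ln 2)^-1 * ln lambda^-1 by rewrite ler_pdivlMl // mulrC.
  have L0 : 0 <= ln lambda^-1 by rewrite ln_ge0.
  have i0 : 0 <= (ln 2)^-1 :> R by rewrite invr_ge0 ltW.
  rewrite -natr1 mulrDl mulrDr; nra.
Qed.

Local Open Scope classical_set_scope.
Local Open Scope ring_scope.

Theorem theorem3 (R : realType) :
  exists C : R, 0 < C /\
    forall F : set int, finite_set F ->
    forall lambda : R, 0 < lambda -> lambda < 1 ->
      (counting [set x : int | (lambda%:E < prime_maximal (\1_F : int -> R) x)%E]
        <= (C * lambda^-1 * ln (expR 1 / lambda) ^+ 2)%:E * counting F)%E.
Proof.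
pose c : R := 1 + (ln 2)^-1.
have c1 : 0 < c by rewrite /c addr_gt0 // invr_gt0 ln_gt0 // ltr1n.
have K0 : 0 < core_const R by exact: core_const_gt0.
exists (2 * core_const R * c ^+ 2); split.
  by apply: mulr_gt0; [exact: mulr_gt0|exact: exprn_gt0].
move=> F finF lambda l0 l1; have [a [a0 la a2 aL]] := dyadic_level l0 l1.
rewrite [X in (_ * X)%E]/counting asboolT // -EFinM; apply: counting_le => s us sE.
set L := ln (expR 1 / lambda) in aL *.
apply: (@le_trans _ _ (core_const R * (a%:R ^+ 2 * 2 ^+ a) * (size (fset_set F))%:R)).
  apply: transference => // x /sE /= /ereal_sup_gt[_ [N /= N0 <-]].
  rewrite lte_fin /prime_avg /prime_pi /primes_upto size_filter big_filter => avg.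
  exists N; set n := count _ _ in avg *.
  have n0 : 0 < n%:R :> R.
    rewrite ltr0n lt0n; apply: contraTneq avg => ->.
    by rewrite invr0 mul0r -leNgt ltW.
  move: avg; rewrite mulrC ltr_pdivlMr // => avg.
  have A0 : 0 < 2 ^+ a :> R by rewrite exprn_gt0.
  have lt1 : n%:R < 2 ^+ a * (lambda * n%:R).
    by rewrite mulrA [2 ^+ a * _]mulrC ltr_pMl.
  apply: lt_trans lt1 _; rewrite ltr_pM2l //; apply: lt_le_trans avg _.
  apply: ler_sum => p _; rewrite indicE in_fset_set //.
rewrite ler_wpM2r //.
have -> : 2 * core_const R * c ^+ 2 / lambda * L ^+ 2
    = core_const R * ((c * L) ^+ 2 * (2 / lambda)).
  by ring.
rewrite ler_pM2l // ler_pM ?sqr_ge0 ?exprn_ge0 //.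
by rewrite lerXn2r ?nnegrE // (le_trans _ aL).
Qed.
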